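(* Let $G$ be a finite simple graph with $\operatorname{mad}(G) < 7$. Then $\tau(G) \leq 2\nu(G)$.
   Context: $\nu(G)$ is the maximum number of pairwise edge-disjoint triangles in $G$. $\tau(G)$ is the minimum size of an edge set $Y \subseteq E(G)$ such that $G - Y$ is triangle-free. The maximum average degree is $\operatorname{mad}(G) = \max\{2|E(H)|/|V(H)| : H \subseteq G,\ V(H)\neq\emptyset\}$. *)

(* Defs.v *)
From mathcomp Require Import all_boot all_order.
Set Implicit Arguments. Unset Strict Implicit. Unset Printing Implicit Defensive.

Section Graph.
Variables (T : finType) (e : rel T).

Definition simple_graph : Prop := symmetric e /\ irreflexive e.

Definition edges : {set {set T}} :=
  [set A : {set T} | [exists x, exists y, e x y && (A == [set x; y])]].

Definition is_triangle (t : {set T}) : bool :=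
  (#|t| == 3) && [forall x in t, forall y in t, (x != y) ==> e x y].

Definition tri_edges (t : {set T}) : {set {set T}} :=
  [set A in powerset t | #|A| == 2].

Definition edge_disjoint_triangles (P : {set {set T}}) : Prop :=
  (forall t, t \in P -> is_triangle t) /\
  (forall t1 t2, t1 \in P -> t2 \in P -> t1 != t2 ->
     [disjoint tri_edges t1 & tri_edges t2]).

Definition triangle_transversal (Y : {set {set T}}) : Prop :=
  Y \subset edges /\
  (forall t, is_triangle t -> exists2 A, A \in tri_edges t & A \in Y).

Definition is_nu (k : nat) : Prop :=
  (exists P, edge_disjoint_triangles P /\ #|P| = k) /\
  (forall P, edge_disjoint_triangles P -> #|P| <= k).

Definition is_tau (k : nat) : Prop :=
  (exists Y, triangle_transversal Y /\ #|Y| = k) /\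
  (forall Y, triangle_transversal Y -> k <= #|Y|).

Definition subgraph (S : {set T}) (F : {set {set T}}) : Prop :=
  F \subset edges /\ (forall A, A \in F -> A \subset S).

(* mad(G) < c  (for rational c = p/q with q > 0):
   every subgraph H with V(H) nonempty has 2|E(H)|/|V(H)| < p/q *)
Definition mad_lt (p q : nat) : Prop :=
  forall S F, subgraph S F -> S != set0 -> 2 * #|F| * q < p * #|S|.

End Graph.

(* Main.v *)
(** In a counterexample with fewest edges there is no "reducible" edge set [X]:
    one that contains a set [S] and a packing [P] with #|S| <= 2 * #|P| such that
    every triangle meeting [X] already meets [S]; deleting such an [X] would give
    a smaller counterexample. A finite search for reducible sets around one or
    two vertices, recorded as decision trees and replayed by a checker, shows
    that in such a graph (without isolated vertices):
    - degrees are at least 5, and a vertex of degree 5 or 6 ("small") has a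
      neighbourhood whose complement is a matching;
    - small vertices are pairwise nonadjacent;
    - a small neighbour of a vertex of degree 7 has degree 5 and belongs to one
      specific configuration;
    - a vertex of degree 9 has at most five small neighbours, and a vertex of
      degree 8 at most three, of which at most two have degree 5.
    Small vertices can then collect enough charge from their large neighbours
    to bring every degree up to 7, contradicting mad < 7. *)
Require Import Defs.
From mathcomp Require Import all_boot all_order zify.
Set Implicit Arguments. Unset Strict Implicit. Unset Printing Implicit Defensive.

(** * Reducible edge sets *)

Section Reduction.
Variables (T : finType).
Implicit Types (e : rel T) (X P S Y : {set {set T}}) (t A : {set T}).

(** Around a single vertex v, reducibility is a matching question: a matching of k edges in the
    graph on the neighbours of v packs k triangles, and X is reducible if those k edges together
    with k further edges or spokes hit every triangle at v. Nearly complete neighbourhoods of 5 or 6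
    vertices escape this, so such vertices cannot be excluded. In exchange they share at least three
    neighbours with each of their neighbours, and since all these are large, a vertex with small
    neighbours also has many large ones.

    The obstacle is degree 7, where there is no charge to give away although one configuration with
    a neighbour of degree 5 resists reduction. The three vertices adjacent to both centres of that
    configuration pay instead: each has at least seven large neighbours, so it could afford a full
    unit for every small one. The shares 1/6, 2/5 and 2/3 sent to small vertices explain the unit
    1/30.

    Deleting edges keeps the vertex set, so isolated vertices do occur; the bound on mad is applied
    to the subgraph on the other vertices. *)

Definition irreducible e := forall X P S,
  X != set0 -> X \subset edges e -> S \subset X ->
  edge_disjoint_triangles e P -> (forall t, t \in P -> tri_edges t \subset X) ->
  #|S| <= 2 * #|P| ->
  exists t, [/\ is_triangle e t, ~~ [disjoint tri_edges t & X]
              & [disjoint tri_edges t & S]].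

Definition delete_edges e X : rel T :=
  fun x y => e x y && ([set x; y] \notin X).

Lemma edgesP e A :
  reflect (exists x y, e x y /\ A = [set x; y]) (A \in edges e).
Proof.
rewrite inE; apply: (iffP existsP) => [[x /existsP[y /andP[exy /eqP->]]]|[x [y [exy ->]]]].
  by exists x, y.
by exists x; apply/existsP; exists y; rewrite exy eqxx.
Qed.

Lemma edges_delete e X : edges (delete_edges e X) = edges e :\: X.
Proof.
apply/setP => A; rewrite in_setD; apply/edgesP/andP => [[x [y [/andP[exy nX] ->]]]|].
  by split=> //; apply/edgesP; exists x, y.
by case=> nX /edgesP[x [y [exy eA]]]; exists x, y; rewrite /delete_edges exy -eA nX.
Qed.

Lemma in_tri_edges t A : (A \in tri_edges t) = (A \subset t) && (#|A| == 2).
Proof. by rewrite !inE. Qed.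

Lemma tri_edges_set2 t x y :
  x != y -> x \in t -> y \in t -> [set x; y] \in tri_edges t.
Proof. by move=> xy xt yt; rewrite in_tri_edges subUset !sub1set xt yt cards2 xy. Qed.

Lemma tri_edgesP t A :
  reflect (exists x y, [/\ x != y, x \in t, y \in t & A = [set x; y]])
          (A \in tri_edges t).
Proof.
apply: (iffP idP) => [|[x [y [xy xt yt ->]]]]; last exact: tri_edges_set2.
rewrite in_tri_edges => /andP[sub /cards2P[x [y [xy eA]]]].
by exists x, y; rewrite xy eA; split=> //; apply: (subsetP sub); rewrite eA !inE eqxx ?orbT.
Qed.

Lemma triangle_edge e t x y :
  is_triangle e t -> x \in t -> y \in t -> x != y -> e x y.
Proof. by case/andP=> _ /forall_inP h xt yt; move/forall_inP: (h x xt) => /(_ y yt)/implyP. Qed.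

Lemma tri_edges_neq0 e t : is_triangle e t -> tri_edges t != set0.
Proof.
case/andP=> /eqP c3 _; have /card_gt1P[x [y [xt yt xy]]] : 1 < #|t| by rewrite c3.
by apply/set0Pn; exists [set x; y]; apply: tri_edges_set2.
Qed.

Lemma triangle_delete e X t :
  is_triangle (delete_edges e X) t = is_triangle e t && [disjoint tri_edges t & X].
Proof.
apply/idP/andP => [h|[h d]].
  have he x y : x \in t -> y \in t -> x != y -> delete_edges e X x y by exact: triangle_edge.
  case/andP: (h) => c3 _; split.
    rewrite /is_triangle c3; apply/forall_inP => x xt; apply/forall_inP => y yt.
    by apply/implyP => xy; case/andP: (he x y xt yt xy).
  rewrite disjoint_subset; apply/subsetP => A /tri_edgesP[x [y [xy xt yt ->]]].
  by case/andP: (he x y xt yt xy).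
case/andP: (h) => c3 _; rewrite /is_triangle c3; apply/forall_inP => x xt; apply/forall_inP => y yt.
apply/implyP => xy; rewrite /delete_edges (triangle_edge h) //=.
by rewrite (disjointFr d) //; apply: tri_edges_set2.
Qed.

(** * Deleting a reducible edge set *)

(** Witnesses replace the two optima: a packing and a transversal of a smaller graph extend by
    unions, and they bound [tau] and [nu] from the useful sides. *)
Definition tuza_bound e :=
  exists P Y, [/\ edge_disjoint_triangles e P, triangle_transversal e Y & #|Y| <= 2 * #|P|].

(** A triangle avoiding X survives the deletion and is hit by [Y']; a triangle meeting X is hit by
    S. The two packings combine because the triangles of P have all edges in X and those of [P']
    have none. *)
Lemma tuza_bound_delete e X P S :
  X \subset edges e -> S \subset X ->
  edge_disjoint_triangles e P -> (forall t, t \in P -> tri_edges t \subset X) ->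
  #|S| <= 2 * #|P| ->
  (forall t, is_triangle e t -> ~~ [disjoint tri_edges t & X] ->
     ~~ [disjoint tri_edges t & S]) ->
  tuza_bound (delete_edges e X) -> tuza_bound e.
Proof.
move=> Xe SX [Ptri Pdis] PX leSP hit [P' [Y' [[P'tri P'dis] [Y'e Y'hit] leYP]]].
have PP'dis t t' : t \in P -> t' \in P' -> [disjoint tri_edges t & tri_edges t'].
  move=> tP /P'tri; rewrite triangle_delete => /andP[_ d].
  by rewrite disjoint_sym; apply: disjointWr d; apply: PX.
exists (P :|: P'), (S :|: Y'); split.
- split=> [t|t1 t2].
    by case/setUP=> [/Ptri//|/P'tri]; rewrite triangle_delete => /andP[].
  case/setUP=> h1 /setUP[] h2 ne; [exact: Pdis|exact: PP'dis| |exact: P'dis].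
  by rewrite disjoint_sym; apply: PP'dis.
- split.
    rewrite subUset (subset_trans SX Xe); apply: subset_trans Y'e _.
    by rewrite edges_delete subsetDl.
  move=> t tt; have [d|nd] := boolP [disjoint tri_edges t & X].
    have [|A At AY] := Y'hit t; first by rewrite triangle_delete tt d.
    by exists A; rewrite // in_setU AY orbT.
  have := hit t tt nd; rewrite disjoints_subset => /subsetPn[A At].
  by rewrite inE negbK => AS; exists A; rewrite // in_setU AS.
(* For the count P and [P'] must be disjoint as sets too: a common triangle would be edge-disjoint
   from itself, yet it has edges. *)
have dPP' : [disjoint P & P'].
  rewrite disjoint_subset; apply/subsetP => t tP; rewrite inE; apply/negP => tP'.
  have := PP'dis t t tP tP'; rewrite -setI_eq0 setIid => /eqP e0.
  by have := tri_edges_neq0 (Ptri t tP); rewrite e0 eqxx.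
have := (leq_card_setU S Y').1; rewrite (cardsU P) (disjoint_setI0 dPP') cards0.
lia.
Qed.

Lemma delete_simple e X : simple_graph e -> simple_graph (delete_edges e X).
Proof.
by move=> [sym irr]; split=> [x y|x]; rewrite /delete_edges ?irr // sym setUC.
Qed.

Lemma delete_mad e X p q : mad_lt e p q -> mad_lt (delete_edges e X) p q.
Proof.
move=> mad U F [Fe FU]; apply: mad; split=> //.
by apply: subset_trans Fe _; rewrite edges_delete subsetDl.
Qed.

(* A counterexample with fewest edges is irreducible: deleting [X] from it
   lowers tau by at most #|S| and nu by at least #|P|. *)
Lemma minimal_counterexample p q :
  (forall e, simple_graph e -> mad_lt e p q -> edges e != set0 ->
     ~ irreducible e) ->
  forall e, simple_graph e -> mad_lt e p q -> ~ ~ tuza_bound e.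
Proof.
move=> noirr e; have [n] := ubnP #|edges e|.
elim: n e => // n IH e /ltnSE lee simp mad bad.
have [e0|ne0] := eqVneq (edges e) set0.
  apply: bad; exists set0, set0; split; rewrite ?cards0 //.
    by split=> [t|t1 t2]; rewrite inE.
  split=> [|t tt]; first exact: sub0set.
  have /set0Pn[A /tri_edgesP[x [y [xy xt yt _]]]] := tri_edges_neq0 tt.
  have : [set x; y] \in edges e.
    by apply/edgesP; exists x, y; split=> //; apply: triangle_edge tt xt yt xy.
  by rewrite e0 inE.
apply: (noirr e simp mad ne0) => X P S X0 Xe SX Pd PX leSP.
(* The existence of the required triangle is a boolean, so it may be proved by contradiction. The
   double negation in the goal avoids having to decide [tuza_bound]. *)
pose b := [exists t, [&& is_triangle e t, ~~ [disjoint tri_edges t & X]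
  & [disjoint tri_edges t & S]]].
have [/existsP[t /and3P[? ? ?]]|/existsPn nt] := boolP b; first by exists t.
exfalso; apply: (IH (delete_edges e X)) => [||//|h]; [|exact: delete_simple|exact: delete_mad|].
  rewrite edges_delete cardsD (setIidPr Xe).
  have : 0 < #|X| by rewrite card_gt0.
  have := subset_leq_card Xe; lia.
apply: bad; apply: (tuza_bound_delete Xe SX Pd PX leSP _ h) => t tt nd.
by have := nt t; rewrite tt nd.
Qed.

End Reduction.

(** * Certificates of reducibility *)

Definition joins (l : seq (nat * nat)) i j := ((i, j) \in l) || ((j, i) \in l).

Definition all_pairs (r : rel nat) (l : seq nat) :=
  all (fun i => all (fun j => (i == j) || r i j) l) l.

(* [Reduction V P C]: [P] are the packed triangles, [C] the deleted edges that
   are charged to [P], and [V] the vertices all of whose edges are deleted. *)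
Record reduction := Reduction {
  red_vertices : seq nat; red_packing : seq (seq nat); red_cover : seq (nat * nat) }.

(* A case analysis on a graph whose vertices are numbered: [Branch i j d1 d2]
   continues with [d1] if [i] and [j] are adjacent and with [d2] otherwise. The
   other constructors close a case: [Reduce k] by the [k]-th reduction,
   [Isolated v a] because the edge [va] lies in no triangle, [Path v a b c]
   because [a, b, c] is a path in the complement of the neighbourhood of the low
   vertex [v], and [Few w v] because the low vertex [v] has fewer than three
   common neighbours with [w]. *)
Inductive dtree :=
  | Branch of nat & nat & dtree & dtree
  | Reduce of nat
  | Isolated of nat & nat
  | Path of nat & nat & nat & nat
  | Few of nat & nat.

(* [closed] lists vertices all of whose neighbours are numbered; [E] and [A] list
   the pairs known to be adjacent and nonadjacent. *)
Section Checker.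
Variables (n : nat) (closed low : seq nat) (reds : seq reduction).
Implicit Types (E A : seq (nat * nat)).

(** Here X is C together with all edges at V, and S is C. Only triangles through some v in V need
    attention: the last clause says that if neither spoke at v is in C, then the third edge is
    absent or in C. The clause with [has] makes X nonempty; it also rejects the empty default
    reduction returned for an index out of range. Pairs of C need not be known to be edges. *)
Definition valid_reduction E A (r : reduction) :=
  let: Reduction V P C := r in
  [&& all (mem closed) V, has (fun v => has (joins E v) (iota 0 n)) V,
   all (fun t => [&& size t == 3, uniq t, all (gtn n) t &
     all_pairs (fun i j => joins E i j && [|| i \in V, j \in V | joins C i j]) t]) P,
   uniq P && all (fun t => all (fun u : seq nat => (t == u) ||
     all_pairs (fun i j => ~~ ((i \in u) && (j \in u))) t) P) P,
   size C <= 2 * size P &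
   all (fun v => all_pairs (fun i j => joins A i j || joins C i j)
     [seq i <- iota 0 n | [&& i != v, ~~ joins A v i & ~~ joins C v i]]) V].

Fixpoint check E A (d : dtree) : bool :=
  match d with
  | Branch i j d1 d2 => check ((i, j) :: E) A d1 && check E ((i, j) :: A) d2
  | Reduce k => valid_reduction E A (nth (Reduction [::] [::] [::]) reds k)
  | Isolated v a => [&& v \in closed, joins E v a &
      all (fun i => joins A v i || joins A a i || (i == v) || (i == a)) (iota 0 n)]
  | Path v a b c => [&& v \in low, [&& joins E v a, joins E v b & joins E v c],
      joins A a b && joins A b c & uniq [:: a; b; c] && all (gtn n) [:: a; b; c]]
  | Few w v => [&& w \in closed, v \in low, joins E w v &
      count (fun i => [&& i != v, i != w, ~~ joins A w i & ~~ joins A v i]) (iota 0 n) < 3]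
  end.

End Checker.

Definition star c l : seq (nat * nat) := map (pair c) l.

(* Vertices [0] and [1] are adjacent; [2 .. c+1] are their common neighbours,
   followed by the [p] private neighbours of [0] and the [q] of [1]. *)
Definition two_present c p q :=
  (0, 1) :: star 0 (iota 2 (c + p)) ++ star 1 (iota 2 c ++ iota (2 + c + p) q).
Definition two_absent c p q := star 0 (iota (2 + c + p) q) ++ star 1 (iota (2 + c) p).
Definition check_two c p q low reds E A :=
  check (2 + c + p + q) [:: 0; 1] low reds (two_present c p q ++ E) (two_absent c p q ++ A).
Definition check_one m closed low reds E A :=
  check m.+1 (0 :: closed) low reds (star 0 (iota 1 m) ++ E) A.

(* The certificates below were found by computer search. The digits in the names
   [adj_i_j_c] are the degrees of two adjacent vertices and the number of their
   common neighbours. *)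
Definition deg1_reds : seq reduction := [::].

Definition deg1_tree : dtree := Isolated 0 1.

Definition deg2_reds : seq reduction := [::
  Reduction [:: 0] [:: [:: 0; 1; 2]] [:: (1, 2)]].

Definition deg2_tree : dtree := Branch 1 2 (Reduce 0) (Isolated 0 1).

Definition deg3_reds : seq reduction := [::
  Reduction [:: 0] [:: [:: 0; 2; 3]] [:: (0, 1); (2, 3)];
  Reduction [:: 0] [:: [:: 0; 1; 3]] [:: (0, 1); (1, 3)]].

Definition deg3_tree : dtree := Branch 2 3 (Reduce 0) (Branch 1 2 (Branch 1 3 (Reduce 1)
    (Isolated 0 3)) (Isolated 0 2)).

Definition deg4_reds : seq reduction := [::
  Reduction [:: 0] [:: [:: 0; 3; 4]; [:: 0; 1; 2]] [:: (0, 1); (0, 2); (1, 2); (3, 4)];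
  Reduction [:: 0] [:: [:: 0; 2; 4]; [:: 0; 1; 3]] [:: (0, 1); (0, 2); (1, 3); (2, 4)];
  Reduction [:: 0] [:: [:: 0; 1; 4]; [:: 0; 2; 3]] [:: (0, 1); (1, 4); (2, 3)];
  Reduction [:: 0] [:: [:: 0; 1; 4]] [:: (0, 1); (1, 4)];
  Reduction [:: 0] [:: [:: 0; 2; 3]; [:: 0; 1; 4]] [:: (0, 2); (1, 4); (2, 3)];
  Reduction [:: 0] [:: [:: 0; 2; 4]] [:: (0, 2); (2, 4)];
  Reduction [:: 0] [:: [:: 0; 2; 4]; [:: 0; 1; 3]] [:: (0, 1); (0, 3); (1, 3); (2, 4)];
  Reduction [:: 0] [:: [:: 0; 2; 3]; [:: 0; 1; 4]] [:: (0, 3); (1, 4); (2, 3)];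
  Reduction [:: 0] [:: [:: 0; 3; 4]] [:: (0, 3); (3, 4)];
  Reduction [:: 0] [:: [:: 0; 1; 4]; [:: 0; 2; 3]] [:: (0, 4); (1, 4); (2, 3)];
  Reduction [:: 0] [:: [:: 0; 3; 4]] [:: (0, 4); (3, 4)]].

Definition deg4_tree : dtree := Branch 1 2 (Branch 3 4 (Reduce 0) (Branch 1 3 (Branch 2 4
    (Reduce 1) (Branch 1 4 (Branch 2 3 (Reduce 2) (Reduce 3)) (Isolated 0 4))) (Branch 2 3
    (Branch 1 4 (Reduce 4) (Branch 2 4 (Reduce 5) (Isolated 0 4))) (Isolated 0 3)))) (Branch 1 3
    (Branch 2 4 (Reduce 6) (Branch 2 3 (Branch 1 4 (Reduce 7) (Branch 3 4 (Reduce 8)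
    (Isolated 0 4))) (Isolated 0 2))) (Branch 1 4 (Branch 2 3 (Reduce 9) (Branch 2 4 (Branch 3 4
    (Reduce 10) (Isolated 0 3)) (Isolated 0 2))) (Isolated 0 1))).

(** Certificates for a vertex 0 whose neighbours 1, 2, 3 form a path in the complement: the pairs 12
    and 23 are assumed absent. *)
Definition path5_reds : seq reduction := [::
  Reduction [:: 0] [:: [:: 0; 4; 5]; [:: 0; 1; 3]] [:: (0, 4); (0, 5); (1, 3); (4, 5)];
  Reduction [:: 0] [:: [:: 0; 1; 3]; [:: 0; 2; 5]] [:: (0, 4); (0, 5); (1, 3); (2, 5)];
  Reduction [:: 0] [:: [:: 0; 2; 4]; [:: 0; 1; 3]] [:: (0, 1); (0, 3); (1, 3); (2, 4)];
  Reduction [:: 0] [:: [:: 0; 3; 5]; [:: 0; 2; 4]] [:: (0, 4); (0, 5); (2, 4); (3, 5)];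
  Reduction [:: 0] [:: [:: 0; 3; 4]; [:: 0; 2; 5]] [:: (0, 1); (0, 4); (2, 5); (3, 4)];
  Reduction [:: 0] [:: [:: 0; 3; 4]; [:: 0; 1; 5]] [:: (0, 4); (1, 5); (3, 4)];
  Reduction [:: 0] [:: [:: 0; 4; 5]] [:: (0, 4); (4, 5)];
  Reduction [:: 0] [:: [:: 0; 2; 5]; [:: 0; 3; 4]] [:: (0, 1); (0, 5); (2, 5); (3, 4)];
  Reduction [:: 0] [:: [:: 0; 3; 5]; [:: 0; 1; 4]] [:: (0, 5); (1, 4); (3, 5)];
  Reduction [:: 0] [:: [:: 0; 4; 5]] [:: (0, 5); (4, 5)]].

Definition path5_tree : dtree := Branch 1 3 (Branch 4 5 (Reduce 0) (Branch 2 5 (Reduce 1)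
    (Branch 2 4 (Reduce 2) (Isolated 0 2)))) (Branch 2 4 (Branch 3 5 (Reduce 3) (Branch 3 4
    (Branch 2 5 (Reduce 4) (Branch 1 5 (Reduce 5) (Branch 1 4 (Branch 4 5 (Reduce 6)
    (Isolated 0 5)) (Isolated 0 1)))) (Isolated 0 3))) (Branch 2 5 (Branch 3 4 (Reduce 7)
    (Branch 3 5 (Branch 1 4 (Reduce 8) (Branch 1 5 (Branch 4 5 (Reduce 9) (Isolated 0 4))
    (Isolated 0 1))) (Isolated 0 3))) (Isolated 0 2))).

Definition path6_reds : seq reduction := [::
  Reduction [:: 0] [:: [:: 0; 5; 6]; [:: 0; 2; 4]; [:: 0; 1; 3]] [:: (0, 4); (0, 5); (0, 6);
    (1, 3); (2, 4); (5, 6)];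
  Reduction [:: 0] [:: [:: 0; 1; 3]; [:: 0; 4; 6]; [:: 0; 2; 5]] [:: (0, 4); (0, 5); (0, 6);
    (1, 3); (2, 5); (4, 6)];
  Reduction [:: 0] [:: [:: 0; 1; 3]; [:: 0; 4; 5]; [:: 0; 2; 6]] [:: (0, 1); (0, 2); (0, 3);
    (1, 3); (2, 6); (4, 5)];
  Reduction [:: 0] [:: [:: 0; 2; 6]; [:: 0; 3; 5]; [:: 0; 1; 4]] [:: (0, 1); (0, 2); (0, 3);
    (1, 4); (2, 6); (3, 5)];
  Reduction [:: 0] [:: [:: 0; 2; 5]; [:: 0; 1; 4]; [:: 0; 3; 6]] [:: (0, 1); (0, 2); (0, 3);
    (1, 4); (2, 5); (3, 6)];
  Reduction [:: 0] [:: [:: 0; 2; 6]; [:: 0; 3; 4]] [:: (0, 1); (0, 2); (2, 6); (3, 4)];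
  Reduction [:: 0] [:: [:: 0; 2; 6]; [:: 0; 1; 4]] [:: (0, 1); (0, 2); (1, 4); (2, 6)];
  Reduction [:: 0] [:: [:: 0; 2; 6]; [:: 0; 3; 4]; [:: 0; 1; 5]] [:: (0, 1); (0, 2); (0, 3);
    (1, 5); (2, 6); (3, 4)];
  Reduction [:: 0] [:: [:: 0; 2; 4]; [:: 0; 1; 3]] [:: (0, 5); (0, 6); (1, 3); (2, 4)];
  Reduction [:: 0] [:: [:: 0; 2; 5]; [:: 0; 1; 6]] [:: (0, 2); (0, 3); (1, 6); (2, 5)];
  Reduction [:: 0] [:: [:: 0; 2; 6]; [:: 0; 1; 3]] [:: (0, 2); (0, 3); (1, 3); (2, 6)];
  Reduction [:: 0] [:: [:: 0; 2; 5]; [:: 0; 3; 6]; [:: 0; 1; 4]] [:: (0, 1); (0, 3); (0, 4);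
    (1, 4); (2, 5); (3, 6)];
  Reduction [:: 0] [:: [:: 0; 2; 5]; [:: 0; 1; 6]; [:: 0; 3; 4]] [:: (0, 1); (0, 3); (0, 4);
    (1, 6); (2, 5); (3, 4)];
  Reduction [:: 0] [:: [:: 0; 2; 4]; [:: 0; 1; 6]] [:: (0, 1); (0, 5); (1, 6); (2, 4)];
  Reduction [:: 0] [:: [:: 0; 2; 4]; [:: 0; 1; 6]] [:: (0, 3); (0, 5); (1, 6); (2, 4)];
  Reduction [:: 0] [:: [:: 0; 3; 6]; [:: 0; 2; 4]] [:: (0, 3); (0, 5); (2, 4); (3, 6)];
  Reduction [:: 0] [:: [:: 0; 2; 4]; [:: 0; 3; 6]; [:: 0; 1; 5]] [:: (0, 3); (0, 4); (0, 6);
    (1, 5); (2, 4); (3, 6)];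
  Reduction [:: 0] [:: [:: 0; 2; 4]; [:: 0; 3; 5]; [:: 0; 1; 6]] [:: (0, 1); (0, 2); (0, 4);
    (1, 6); (2, 4); (3, 5)];
  Reduction [:: 0] [:: [:: 0; 1; 5]; [:: 0; 2; 6]] [:: (0, 1); (0, 4); (1, 5); (2, 6)];
  Reduction [:: 0] [:: [:: 0; 2; 4]; [:: 0; 1; 6]] [:: (0, 1); (0, 4); (1, 6); (2, 4)];
  Reduction [:: 0] [:: [:: 0; 1; 5]; [:: 0; 2; 6]] [:: (0, 3); (0, 4); (1, 5); (2, 6)];
  Reduction [:: 0] [:: [:: 0; 4; 6]; [:: 0; 1; 5]] [:: (0, 3); (0, 4); (1, 5); (4, 6)];
  Reduction [:: 0] [:: [:: 0; 2; 4]; [:: 0; 3; 5]; [:: 0; 1; 6]] [:: (0, 2); (0, 3); (0, 4);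
    (1, 6); (2, 4); (3, 5)];
  Reduction [:: 0] [:: [:: 0; 4; 5]; [:: 0; 1; 3]] [:: (0, 4); (0, 6); (1, 3); (4, 5)];
  Reduction [:: 0] [:: [:: 0; 1; 3]; [:: 0; 2; 6]] [:: (0, 3); (0, 4); (1, 3); (2, 6)];
  Reduction [:: 0] [:: [:: 0; 2; 4]; [:: 0; 1; 3]] [:: (0, 3); (0, 4); (1, 3); (2, 4)];
  Reduction [:: 0] [:: [:: 0; 2; 5]; [:: 0; 3; 6]; [:: 0; 1; 4]] [:: (0, 3); (0, 5); (0, 6);
    (1, 4); (2, 5); (3, 6)];
  Reduction [:: 0] [:: [:: 0; 2; 5]; [:: 0; 3; 4]; [:: 0; 1; 6]] [:: (0, 1); (0, 2); (0, 5);
    (1, 6); (2, 5); (3, 4)];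
  Reduction [:: 0] [:: [:: 0; 1; 4]; [:: 0; 2; 6]] [:: (0, 1); (0, 5); (1, 4); (2, 6)];
  Reduction [:: 0] [:: [:: 0; 2; 5]; [:: 0; 1; 6]] [:: (0, 1); (0, 5); (1, 6); (2, 5)];
  Reduction [:: 0] [:: [:: 0; 1; 4]; [:: 0; 2; 6]] [:: (0, 3); (0, 5); (1, 4); (2, 6)];
  Reduction [:: 0] [:: [:: 0; 5; 6]; [:: 0; 1; 4]] [:: (0, 3); (0, 5); (1, 4); (5, 6)];
  Reduction [:: 0] [:: [:: 0; 2; 5]; [:: 0; 3; 4]; [:: 0; 1; 6]] [:: (0, 2); (0, 3); (0, 5);
    (1, 6); (2, 5); (3, 4)];
  Reduction [:: 0] [:: [:: 0; 4; 5]; [:: 0; 1; 3]] [:: (0, 5); (0, 6); (1, 3); (4, 5)];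
  Reduction [:: 0] [:: [:: 0; 1; 3]; [:: 0; 2; 6]] [:: (0, 3); (0, 5); (1, 3); (2, 6)];
  Reduction [:: 0] [:: [:: 0; 2; 5]; [:: 0; 1; 3]] [:: (0, 3); (0, 5); (1, 3); (2, 5)];
  Reduction [:: 0] [:: [:: 0; 2; 6]; [:: 0; 1; 3]; [:: 0; 4; 5]] [:: (0, 1); (0, 3); (0, 6);
    (1, 3); (2, 6); (4, 5)];
  Reduction [:: 0] [:: [:: 0; 2; 6]; [:: 0; 3; 5]; [:: 0; 1; 4]] [:: (0, 1); (0, 3); (0, 6);
    (1, 4); (2, 6); (3, 5)];
  Reduction [:: 0] [:: [:: 0; 2; 6]; [:: 0; 3; 4]] [:: (0, 1); (0, 6); (2, 6); (3, 4)];
  Reduction [:: 0] [:: [:: 0; 2; 6]; [:: 0; 1; 4]] [:: (0, 1); (0, 6); (1, 4); (2, 6)];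
  Reduction [:: 0] [:: [:: 0; 2; 6]; [:: 0; 1; 5]] [:: (0, 3); (0, 6); (1, 5); (2, 6)];
  Reduction [:: 0] [:: [:: 0; 2; 6]; [:: 0; 1; 3]] [:: (0, 3); (0, 6); (1, 3); (2, 6)];
  Reduction [:: 0] [:: [:: 0; 3; 6]; [:: 0; 2; 5]; [:: 0; 1; 4]] [:: (0, 4); (0, 5); (0, 6);
    (1, 4); (2, 5); (3, 6)];
  Reduction [:: 0] [:: [:: 0; 2; 5]; [:: 0; 3; 4]; [:: 0; 1; 6]] [:: (0, 2); (0, 4); (0, 5);
    (1, 6); (2, 5); (3, 4)];
  Reduction [:: 0] [:: [:: 0; 3; 5]; [:: 0; 1; 6]; [:: 0; 2; 4]] [:: (0, 2); (0, 4); (0, 5);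
    (1, 6); (2, 4); (3, 5)];
  Reduction [:: 0] [:: [:: 0; 3; 5]; [:: 0; 1; 4]] [:: (0, 5); (0, 6); (1, 4); (3, 5)];
  Reduction [:: 0] [:: [:: 0; 1; 4]; [:: 0; 2; 6]] [:: (0, 4); (0, 5); (1, 4); (2, 6)];
  Reduction [:: 0] [:: [:: 0; 2; 5]; [:: 0; 1; 4]] [:: (0, 4); (0, 5); (1, 4); (2, 5)];
  Reduction [:: 0] [:: [:: 0; 1; 4]; [:: 0; 3; 5]; [:: 0; 2; 6]] [:: (0, 1); (0, 4); (0, 6);
    (1, 4); (2, 6); (3, 5)];
  Reduction [:: 0] [:: [:: 0; 2; 6]; [:: 0; 1; 5]] [:: (0, 4); (0, 6); (1, 5); (2, 6)];
  Reduction [:: 0] [:: [:: 0; 2; 6]; [:: 0; 1; 4]] [:: (0, 4); (0, 6); (1, 4); (2, 6)];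
  Reduction [:: 0] [:: [:: 0; 2; 4]; [:: 0; 1; 6]] [:: (0, 4); (0, 5); (1, 6); (2, 4)];
  Reduction [:: 0] [:: [:: 0; 2; 4]; [:: 0; 1; 5]] [:: (0, 4); (0, 5); (1, 5); (2, 4)];
  Reduction [:: 0] [:: [:: 0; 2; 4]; [:: 0; 3; 5]] [:: (0, 4); (0, 6); (2, 4); (3, 5)];
  Reduction [:: 0] [:: [:: 0; 2; 4]; [:: 0; 5; 6]] [:: (0, 4); (0, 6); (2, 4); (5, 6)];
  Reduction [:: 0] [:: [:: 0; 4; 5]; [:: 0; 3; 6]] [:: (0, 1); (0, 4); (3, 6); (4, 5)];
  Reduction [:: 0] [:: [:: 0; 4; 6]] [:: (0, 4); (4, 6)];
  Reduction [:: 0] [:: [:: 0; 3; 6]; [:: 0; 2; 4]; [:: 0; 1; 5]] [:: (0, 3); (0, 5); (0, 6);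
    (1, 5); (2, 4); (3, 6)];
  Reduction [:: 0] [:: [:: 0; 3; 4]; [:: 0; 1; 5]] [:: (0, 4); (0, 6); (1, 5); (3, 4)];
  Reduction [:: 0] [:: [:: 0; 1; 5]; [:: 0; 2; 6]] [:: (0, 4); (0, 5); (1, 5); (2, 6)];
  Reduction [:: 0] [:: [:: 0; 1; 5]; [:: 0; 3; 4]] [:: (0, 5); (0, 6); (1, 5); (3, 4)];
  Reduction [:: 0] [:: [:: 0; 1; 5]; [:: 0; 4; 6]] [:: (0, 5); (0, 6); (1, 5); (4, 6)];
  Reduction [:: 0] [:: [:: 0; 4; 5]; [:: 0; 3; 6]] [:: (0, 5); (0, 6); (3, 6); (4, 5)];
  Reduction [:: 0] [:: [:: 0; 4; 5]; [:: 0; 2; 6]] [:: (0, 1); (0, 5); (2, 6); (4, 5)];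
  Reduction [:: 0] [:: [:: 0; 5; 6]] [:: (0, 5); (5, 6)];
  Reduction [:: 0] [:: [:: 0; 1; 6]; [:: 0; 3; 5]; [:: 0; 2; 4]] [:: (0, 2); (0, 4); (0, 6);
    (1, 6); (2, 4); (3, 5)];
  Reduction [:: 0] [:: [:: 0; 1; 6]; [:: 0; 2; 5]] [:: (0, 4); (0, 6); (1, 6); (2, 5)];
  Reduction [:: 0] [:: [:: 0; 2; 4]; [:: 0; 1; 6]] [:: (0, 4); (0, 6); (1, 6); (2, 4)];
  Reduction [:: 0] [:: [:: 0; 1; 6]; [:: 0; 3; 4]] [:: (0, 5); (0, 6); (1, 6); (3, 4)];
  Reduction [:: 0] [:: [:: 0; 1; 6]; [:: 0; 4; 5]] [:: (0, 5); (0, 6); (1, 6); (4, 5)];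
  Reduction [:: 0] [:: [:: 0; 4; 6]; [:: 0; 3; 5]] [:: (0, 2); (0, 6); (3, 5); (4, 6)];
  Reduction [:: 0] [:: [:: 0; 5; 6]] [:: (0, 6); (5, 6)]].

Definition path6_tree : dtree := Branch 1 3 (Branch 2 4 (Branch 5 6 (Reduce 0) (Branch 2 5
    (Branch 4 6 (Reduce 1) (Branch 2 6 (Branch 4 5 (Reduce 2) (Branch 1 4 (Branch 3 5 (Reduce 3)
    (Branch 3 6 (Reduce 4) (Branch 3 4 (Reduce 5) (Reduce 6)))) (Branch 1 5 (Branch 3 4 (Reduce 7)
    (Reduce 8)) (Branch 1 6 (Reduce 9) (Reduce 10))))) (Branch 1 4 (Branch 3 6 (Reduce 11)
    (Branch 1 6 (Branch 3 4 (Reduce 12) (Reduce 13)) (Isolated 0 6))) (Branch 1 6 (Reduce 14)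
    (Branch 3 6 (Reduce 15) (Isolated 0 6)))))) (Branch 1 5 (Branch 3 6 (Reduce 16) (Branch 1 6
    (Branch 3 5 (Reduce 17) (Branch 2 6 (Reduce 18) (Reduce 19))) (Branch 2 6 (Reduce 20)
    (Branch 4 6 (Reduce 21) (Isolated 0 6))))) (Branch 1 6 (Branch 3 5 (Reduce 22) (Branch 4 5
    (Reduce 23) (Isolated 0 5))) (Branch 2 6 (Reduce 24) (Reduce 25)))))) (Branch 2 5 (Branch 4 6
    (Reduce 1) (Branch 1 4 (Branch 3 6 (Reduce 26) (Branch 1 6 (Branch 3 4 (Reduce 27) (Branch 2 6
    (Reduce 28) (Reduce 29))) (Branch 2 6 (Reduce 30) (Branch 5 6 (Reduce 31) (Isolated 0 6)))))
    (Branch 1 6 (Branch 3 4 (Reduce 32) (Branch 4 5 (Reduce 33) (Isolated 0 4))) (Branch 2 6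
    (Reduce 34) (Reduce 35))))) (Branch 2 6 (Branch 4 5 (Reduce 36) (Branch 1 4 (Branch 3 5
    (Reduce 37) (Branch 3 4 (Reduce 38) (Reduce 39))) (Branch 1 5 (Reduce 40) (Reduce 41))))
    (Isolated 0 2)))) (Branch 1 4 (Branch 2 5 (Branch 3 6 (Reduce 42) (Branch 1 6 (Branch 3 4
    (Reduce 43) (Branch 3 5 (Branch 2 4 (Reduce 44) (Reduce 45)) (Isolated 0 3))) (Branch 2 6
    (Reduce 46) (Reduce 47)))) (Branch 2 6 (Branch 3 5 (Reduce 48) (Branch 1 5 (Reduce 49)
    (Reduce 50))) (Branch 2 4 (Branch 1 5 (Branch 3 6 (Reduce 16) (Branch 1 6 (Reduce 51)
    (Reduce 52))) (Branch 3 5 (Reduce 53) (Branch 5 6 (Reduce 54) (Branch 4 5 (Branch 3 6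
    (Reduce 55) (Branch 3 4 (Branch 1 6 (Reduce 19) (Branch 4 6 (Reduce 56) (Isolated 0 6)))
    (Isolated 0 3))) (Isolated 0 5))))) (Isolated 0 2)))) (Branch 1 5 (Branch 2 4 (Branch 3 6
    (Reduce 57) (Branch 1 6 (Branch 3 5 (Reduce 44) (Branch 3 4 (Branch 2 5 (Reduce 43)
    (Reduce 58)) (Isolated 0 3))) (Branch 2 6 (Reduce 59) (Reduce 52)))) (Branch 3 4 (Reduce 60)
    (Branch 4 6 (Reduce 61) (Branch 4 5 (Branch 3 6 (Reduce 62) (Branch 3 5 (Branch 2 6 (Reduce 63)
    (Branch 2 5 (Branch 1 6 (Reduce 29) (Branch 5 6 (Reduce 64) (Isolated 0 6))) (Isolated 0 2)))
    (Isolated 0 3))) (Isolated 0 4))))) (Branch 1 6 (Branch 2 4 (Branch 3 5 (Reduce 65) (Branch 2 5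
    (Reduce 66) (Reduce 67))) (Branch 3 4 (Reduce 68) (Branch 4 5 (Reduce 69) (Branch 4 6
    (Branch 3 5 (Reduce 70) (Branch 3 6 (Branch 2 5 (Reduce 66) (Branch 2 6 (Branch 5 6 (Reduce 71)
    (Isolated 0 5)) (Isolated 0 2))) (Isolated 0 3))) (Isolated 0 4))))) (Isolated 0 1)))).

Definition adj_5_5_4_reds : seq reduction := [::
  Reduction [:: 0; 1] [:: [:: 0; 1; 5]; [:: 1; 3; 4]; [:: 0; 2; 4]] [:: (0, 1); (0, 5); (1, 5);
    (2, 3); (2, 4); (3, 4)];
  Reduction [:: 0; 1] [:: [:: 1; 4; 5]; [:: 1; 2; 3]; [:: 0; 3; 5]] [:: (0, 1); (0, 2); (1, 2);
    (2, 3); (3, 5); (4, 5)];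
  Reduction [:: 0; 1] [:: [:: 1; 4; 5]; [:: 1; 2; 3]; [:: 0; 3; 4]] [:: (0, 1); (0, 5); (1, 5);
    (2, 3); (3, 4); (4, 5)]].

Definition adj_5_5_4_tree : dtree := Branch 2 4 (Branch 3 4 (Reduce 0) (Branch 2 3 (Branch 3 5
    (Branch 4 5 (Reduce 1) (Path 0 3 4 5)) (Path 0 4 3 5)) (Path 0 2 3 4))) (Branch 2 3 (Branch 2 5
    (Branch 3 4 (Branch 4 5 (Reduce 2) (Path 0 2 4 5)) (Path 0 2 4 3)) (Path 0 4 2 5))
    (Path 0 3 2 4)).

Definition adj_5_5_3_reds : seq reduction := [::
  Reduction [:: 0; 1] [:: [:: 1; 4; 6]; [:: 0; 3; 5]; [:: 0; 1; 2]] [:: (0, 2); (0, 4); (1, 2);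
    (1, 3); (3, 5); (4, 6)]].

Definition adj_5_5_3_tree : dtree := Branch 2 5 (Branch 2 6 (Branch 3 5 (Branch 3 6 (Branch 4 5
    (Branch 4 6 (Reduce 0) (Path 1 0 6 4)) (Path 0 1 5 4)) (Path 1 0 6 3)) (Path 0 1 5 3))
    (Path 1 0 6 2)) (Path 0 1 5 2).

Definition adj_5_6_4_reds : seq reduction := [::
  Reduction [:: 0; 1] [:: [:: 1; 5; 6]; [:: 0; 1; 4]; [:: 1; 2; 3]; [:: 0; 3; 5]] [:: (0, 4);
    (0, 5); (1, 2); (1, 3); (1, 4); (2, 3); (3, 5); (5, 6)];
  Reduction [:: 0; 1] [:: [:: 1; 5; 6]; [:: 1; 3; 4]; [:: 0; 3; 5]; [:: 0; 2; 4]] [:: (0, 5);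
    (1, 2); (1, 3); (1, 4); (2, 4); (3, 4); (3, 5); (5, 6)];
  Reduction [:: 0; 1] [:: [:: 1; 5; 6]; [:: 1; 3; 4]; [:: 0; 4; 5]; [:: 0; 2; 3]] [:: (0, 1);
    (0, 2); (1, 2); (1, 6); (2, 3); (3, 4); (4, 5); (5, 6)]].

Definition adj_5_6_4_tree : dtree := Branch 2 6 (Branch 3 6 (Branch 4 6 (Branch 5 6 (Branch 3 5
    (Branch 2 3 (Reduce 0) (Branch 2 4 (Branch 2 5 (Branch 3 4 (Reduce 1) (Path 0 2 3 4))
    (Path 0 3 2 5)) (Path 0 3 2 4))) (Branch 2 3 (Branch 2 5 (Branch 3 4 (Branch 4 5 (Reduce 2)
    (Path 0 3 5 4)) (Path 0 4 3 5)) (Path 0 2 5 3)) (Path 0 2 3 5))) (Path 1 0 6 5))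
    (Path 1 0 6 4)) (Path 1 0 6 3)) (Path 1 0 6 2).

Definition adj_6_6_5_reds : seq reduction := [::
  Reduction [:: 0; 1] [:: [:: 0; 1; 6]; [:: 1; 4; 5]; [:: 1; 2; 3]; [:: 0; 3; 5]; [:: 0; 2; 4]]
    [:: (0, 4); (0, 5); (0, 6); (1, 2); (1, 3); (1, 6); (2, 3); (2, 4); (3, 5); (4, 5)];
  Reduction [:: 0; 1] [:: [:: 1; 5; 6]; [:: 1; 3; 4]; [:: 0; 4; 6]; [:: 0; 3; 5]] [:: (0, 1);
    (0, 2); (1, 2); (3, 4); (3, 5); (3, 6); (4, 6); (5, 6)];
  Reduction [:: 0; 1] [:: [:: 1; 3; 6]; [:: 1; 2; 5]; [:: 0; 3; 5]; [:: 0; 2; 6]] [:: (0, 1);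
    (0, 4); (1, 4); (2, 5); (2, 6); (3, 5); (3, 6); (5, 6)];
  Reduction [:: 0; 1] [:: [:: 1; 5; 6]; [:: 1; 3; 4]; [:: 0; 4; 5]; [:: 0; 3; 6]] [:: (0, 1);
    (0, 2); (1, 2); (3, 4); (3, 6); (4, 5); (4, 6); (5, 6)];
  Reduction [:: 0; 1] [:: [:: 1; 4; 6]; [:: 1; 2; 5]; [:: 0; 4; 5]; [:: 0; 2; 6]] [:: (0, 1);
    (0, 3); (1, 3); (2, 5); (2, 6); (4, 5); (4, 6); (5, 6)]].

Definition adj_6_6_5_tree : dtree := Branch 2 4 (Branch 3 5 (Branch 2 3 (Branch 4 5 (Reduce 0)
    (Branch 2 5 (Branch 3 4 (Branch 4 6 (Branch 5 6 (Reduce 1) (Path 0 4 5 6)) (Path 0 5 4 6))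
    (Path 0 3 4 5)) (Path 0 2 5 4))) (Branch 2 5 (Branch 2 6 (Branch 3 4 (Branch 3 6 (Reduce 2)
    (Path 0 2 3 6)) (Path 0 2 3 4)) (Path 0 3 2 6)) (Path 0 3 2 5))) (Branch 2 3 (Branch 2 5
    (Branch 3 4 (Branch 3 6 (Branch 4 5 (Branch 5 6 (Reduce 3) (Path 0 3 5 6)) (Path 0 3 5 4))
    (Path 0 5 3 6)) (Path 0 4 3 5)) (Path 0 2 5 3)) (Path 0 2 3 5))) (Branch 2 3 (Branch 2 5
    (Branch 2 6 (Branch 3 4 (Branch 4 5 (Branch 4 6 (Reduce 4) (Path 0 2 4 6)) (Path 0 2 4 5))
    (Path 0 2 4 3)) (Path 0 4 2 6)) (Path 0 4 2 5)) (Path 0 3 2 4)).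

Definition adj_6_6_4_reds : seq reduction := [::
  Reduction [:: 0; 1] [:: [:: 1; 5; 7]; [:: 0; 4; 6]; [:: 0; 1; 3]; [:: 1; 2; 4]; [:: 0; 2; 5]]
    [:: (0, 2); (0, 3); (0, 5); (1, 2); (1, 3); (1, 4); (2, 4); (2, 5); (4, 6); (5, 7)];
  Reduction [:: 0; 1] [:: [:: 1; 5; 7]; [:: 1; 3; 4]; [:: 0; 4; 6]; [:: 0; 1; 2]; [:: 2; 3; 6]]
    [:: (0, 5); (1, 2); (1, 3); (1, 4); (2, 3); (2, 6); (3, 4); (3, 6); (4, 6); (5, 7)];
  Reduction [:: 0; 1] [:: [:: 1; 5; 7]; [:: 1; 2; 4]; [:: 0; 4; 5]; [:: 0; 2; 6]; [:: 0; 1; 3]]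
    [:: (0, 3); (0, 4); (0, 5); (1, 2); (1, 3); (1, 4); (2, 4); (2, 6); (4, 5); (5, 7)]].

Definition adj_6_6_4_tree : dtree := Branch 2 6 (Branch 2 7 (Branch 3 6 (Branch 3 7 (Branch 4 6
    (Branch 4 7 (Branch 5 6 (Branch 5 7 (Branch 2 5 (Branch 2 4 (Reduce 0) (Branch 2 3 (Branch 3 4
    (Branch 4 5 (Reduce 1) (Path 0 2 4 5)) (Path 0 2 4 3)) (Path 0 3 2 4))) (Branch 2 3 (Branch 2 4
    (Branch 3 5 (Branch 4 5 (Reduce 2) (Path 0 2 5 4)) (Path 0 2 5 3)) (Path 0 4 2 5))
    (Path 0 3 2 5))) (Path 1 0 7 5)) (Path 0 1 6 5)) (Path 1 0 7 4)) (Path 0 1 6 4))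
    (Path 1 0 7 3)) (Path 0 1 6 3)) (Path 1 0 7 2)) (Path 0 1 6 2).

Definition adj_5_7_4_reds : seq reduction := [::
  Reduction [:: 0; 1] [:: [:: 1; 2; 3]; [:: 1; 6; 7]; [:: 1; 4; 5]; [:: 0; 3; 5]; [:: 0; 2; 4]]
    [:: (0, 1); (1, 6); (1, 7); (2, 3); (2, 4); (2, 5); (3, 4); (3, 5); (4, 5); (6, 7)];
  Reduction [:: 0; 1] [:: [:: 1; 4; 5]; [:: 0; 3; 5]; [:: 0; 1; 2]; [:: 1; 3; 7]; [:: 2; 3; 4]]
    [:: (0, 1); (1, 6); (1, 7); (2, 3); (2, 4); (2, 5); (3, 4); (3, 5); (3, 7); (4, 5)];
  Reduction [:: 0; 1] [:: [:: 1; 4; 5]; [:: 0; 3; 5]; [:: 0; 1; 2]; [:: 1; 3; 6]] [:: (0, 2);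
    (0, 3); (1, 2); (1, 4); (1, 5); (3, 5); (3, 6); (4, 5)];
  Reduction [:: 1] [:: [:: 1; 4; 5]; [:: 0; 1; 3]; [:: 1; 2; 7]] [:: (0, 3); (1, 2); (1, 4);
    (1, 5); (2, 7); (4, 5)];
  Reduction [:: 1] [:: [:: 1; 4; 5]; [:: 0; 1; 3]; [:: 1; 2; 6]] [:: (0, 3); (1, 2); (1, 4);
    (1, 5); (2, 6); (4, 5)];
  Reduction [:: 0; 1] [:: [:: 1; 4; 5]; [:: 1; 2; 3]; [:: 0; 3; 5]; [:: 0; 2; 4]] [:: (0, 2);
    (0, 3); (1, 4); (1, 5); (2, 3); (2, 4); (3, 5); (4, 5)];
  Reduction [:: 0; 1] [:: [:: 1; 4; 5]; [:: 1; 2; 3]; [:: 0; 3; 5]; [:: 0; 2; 4]] [:: (0, 1);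
    (1, 6); (1, 7); (2, 3); (2, 4); (2, 5); (3, 5); (4, 5)];
  Reduction [:: 0; 1] [:: [:: 1; 3; 5]; [:: 1; 2; 4]; [:: 0; 3; 4]; [:: 0; 2; 5]] [:: (0, 1);
    (1, 6); (1, 7); (2, 3); (2, 4); (2, 5); (3, 4); (3, 5)];
  Reduction [:: 0; 1] [:: [:: 1; 4; 5]; [:: 1; 2; 3]; [:: 0; 3; 4]; [:: 0; 2; 5]] [:: (0, 1);
    (1, 6); (1, 7); (2, 3); (2, 4); (2, 5); (3, 4); (4, 5)];
  Reduction [:: 0; 1] [:: [:: 1; 4; 5]; [:: 1; 2; 3]; [:: 0; 3; 4]; [:: 0; 2; 5]] [:: (0, 1);
    (1, 6); (1, 7); (2, 3); (2, 5); (3, 4); (3, 5); (4, 5)];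
  Reduction [:: 0; 1] [:: [:: 1; 3; 5]; [:: 1; 2; 4]; [:: 0; 3; 4]; [:: 0; 2; 5]] [:: (0, 1);
    (1, 6); (1, 7); (2, 4); (2, 5); (3, 4); (3, 5); (4, 5)]].

Definition adj_5_7_4_tree : dtree := Branch 2 3 (Branch 2 4 (Branch 3 5 (Branch 4 5 (Branch 6 7
    (Reduce 0) (Branch 3 4 (Branch 3 7 (Reduce 1) (Branch 3 6 (Reduce 2) (Branch 2 7 (Reduce 3)
    (Branch 2 6 (Reduce 4) (Reduce 5))))) (Reduce 6))) (Branch 2 5 (Branch 3 4 (Reduce 7)
    (Path 0 3 4 5)) (Path 0 2 5 4))) (Branch 2 5 (Branch 3 4 (Branch 4 5 (Reduce 8) (Path 0 3 5 4))
    (Path 0 4 3 5)) (Path 0 2 5 3))) (Branch 2 5 (Branch 3 4 (Branch 4 5 (Reduce 9) (Path 0 2 4 5))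
    (Path 0 2 4 3)) (Path 0 4 2 5))) (Branch 2 4 (Branch 2 5 (Branch 3 4 (Branch 3 5 (Reduce 10)
    (Path 0 2 3 5)) (Path 0 2 3 4)) (Path 0 3 2 5)) (Path 0 3 2 4)).

Definition adj_6_7_5_reds : seq reduction := [::
  Reduction [:: 0; 1] [:: [:: 0; 1; 6]; [:: 1; 4; 5]; [:: 1; 2; 3]; [:: 0; 3; 5]; [:: 0; 2; 4]]
    [:: (0, 1); (0, 6); (1, 6); (1, 7); (2, 3); (2, 4); (2, 5); (3, 4); (3, 5); (4, 5)];
  Reduction [:: 0; 1] [:: [:: 1; 5; 6]; [:: 1; 3; 4]; [:: 0; 4; 6]; [:: 0; 3; 5]; [:: 0; 1; 2]]
    [:: (0, 1); (0, 2); (0, 6); (1, 2); (1, 3); (1, 7); (3, 4); (3, 5); (4, 6); (5, 6)];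
  Reduction [:: 0; 1] [:: [:: 1; 3; 6]; [:: 1; 2; 5]; [:: 0; 3; 5]; [:: 0; 2; 6]; [:: 0; 1; 4]]
    [:: (0, 1); (0, 4); (0, 6); (1, 4); (1, 5); (1, 7); (2, 5); (2, 6); (3, 5); (3, 6)];
  Reduction [:: 0; 1] [:: [:: 1; 5; 6]; [:: 1; 3; 4]; [:: 0; 4; 5]; [:: 0; 3; 6]; [:: 0; 1; 2]]
    [:: (0, 1); (0, 2); (0, 6); (1, 2); (1, 4); (1, 7); (3, 4); (3, 6); (4, 5); (5, 6)];
  Reduction [:: 0; 1] [:: [:: 1; 4; 6]; [:: 1; 2; 5]; [:: 0; 4; 5]; [:: 0; 2; 6]; [:: 0; 1; 3]]
    [:: (0, 1); (0, 3); (0, 6); (1, 3); (1, 5); (1, 7); (2, 5); (2, 6); (4, 5); (4, 6)]].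

Definition adj_6_7_5_tree : dtree := Branch 2 4 (Branch 3 5 (Branch 2 3 (Branch 4 5 (Reduce 0)
    (Branch 2 5 (Branch 3 4 (Branch 4 6 (Branch 5 6 (Reduce 1) (Path 0 4 5 6)) (Path 0 5 4 6))
    (Path 0 3 4 5)) (Path 0 2 5 4))) (Branch 2 5 (Branch 2 6 (Branch 3 4 (Branch 3 6 (Reduce 2)
    (Path 0 2 3 6)) (Path 0 2 3 4)) (Path 0 3 2 6)) (Path 0 3 2 5))) (Branch 2 3 (Branch 2 5
    (Branch 3 4 (Branch 3 6 (Branch 4 5 (Branch 5 6 (Reduce 3) (Path 0 3 5 6)) (Path 0 3 5 4))
    (Path 0 5 3 6)) (Path 0 4 3 5)) (Path 0 2 5 3)) (Path 0 2 3 5))) (Branch 2 3 (Branch 2 5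
    (Branch 2 6 (Branch 3 4 (Branch 4 5 (Branch 4 6 (Reduce 4) (Path 0 2 4 6)) (Path 0 2 4 5))
    (Path 0 2 4 3)) (Path 0 4 2 6)) (Path 0 4 2 5)) (Path 0 3 2 4)).

Definition adj_6_7_4_reds : seq reduction := [::
  Reduction [:: 0; 1] [:: [:: 0; 5; 6]; [:: 0; 1; 4]; [:: 1; 7; 8]; [:: 1; 3; 5]; [:: 0; 2; 3];
    [:: 2; 4; 5]] [:: (0, 1); (0, 6); (1, 7); (1, 8); (2, 3); (2, 4); (2, 5); (3, 4); (3, 5);
    (4, 5); (5, 6); (7, 8)];
  Reduction [:: 0; 1] [:: [:: 1; 4; 5]; [:: 0; 5; 6]; [:: 0; 2; 4]; [:: 0; 1; 3]; [:: 1; 2; 8];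
    [:: 2; 3; 5]] [:: (0, 1); (0, 6); (1, 7); (1, 8); (2, 3); (2, 4); (2, 5); (2, 8); (3, 4);
    (3, 5); (4, 5); (5, 6)];
  Reduction [:: 0; 1] [:: [:: 1; 4; 5]; [:: 0; 5; 6]; [:: 0; 2; 4]; [:: 0; 1; 3]; [:: 1; 2; 7]]
    [:: (0, 2); (0, 3); (0, 6); (1, 3); (1, 4); (1, 5); (2, 4); (2, 7); (4, 5); (5, 6)];
  Reduction [:: 1] [:: [:: 1; 4; 5]; [:: 0; 1; 2]; [:: 1; 3; 8]] [:: (0, 2); (1, 3); (1, 4);
    (1, 5); (3, 8); (4, 5)];
  Reduction [:: 1] [:: [:: 1; 4; 5]; [:: 0; 1; 2]; [:: 1; 3; 7]] [:: (0, 2); (1, 3); (1, 4);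
    (1, 5); (3, 7); (4, 5)];
  Reduction [:: 0; 1] [:: [:: 1; 3; 5]; [:: 0; 5; 6]; [:: 0; 2; 3]; [:: 0; 1; 4]] [:: (0, 2);
    (0, 3); (0, 4); (1, 4); (1, 5); (2, 3); (3, 5); (5, 6)];
  Reduction [:: 0; 1] [:: [:: 1; 4; 5]; [:: 0; 4; 6]; [:: 0; 2; 5]; [:: 0; 1; 3]; [:: 2; 3; 4]]
    [:: (0, 1); (0, 6); (1, 7); (1, 8); (2, 3); (2, 4); (2, 5); (3, 4); (4, 5); (4, 6)];
  Reduction [:: 0; 1] [:: [:: 1; 3; 5]; [:: 0; 5; 6]; [:: 0; 3; 4]; [:: 0; 1; 2]; [:: 2; 4; 5]]
    [:: (0, 1); (0, 6); (1, 7); (1, 8); (2, 4); (2, 5); (3, 4); (3, 5); (4, 5); (5, 6)];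
  Reduction [:: 0; 1] [:: [:: 1; 3; 5]; [:: 1; 2; 4]; [:: 0; 3; 4]; [:: 0; 2; 5]; [:: 1; 7; 8]]
    [:: (0, 1); (0, 6); (1, 7); (1, 8); (2, 3); (2, 4); (2, 5); (3, 4); (3, 5); (7, 8)];
  Reduction [:: 0; 1] [:: [:: 1; 3; 5]; [:: 0; 5; 6]; [:: 0; 3; 4]; [:: 0; 1; 2]; [:: 1; 4; 8]]
    [:: (0, 2); (0, 6); (1, 2); (1, 3); (1, 4); (1, 5); (3, 4); (3, 5); (4, 8); (5, 6)];
  Reduction [:: 0; 1] [:: [:: 1; 3; 5]; [:: 0; 5; 6]; [:: 0; 3; 4]; [:: 0; 1; 2]; [:: 1; 4; 7]]
    [:: (0, 2); (0, 3); (0, 4); (1, 2); (1, 3); (1, 5); (3, 4); (3, 5); (4, 7); (5, 6)];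
  Reduction [:: 1] [:: [:: 1; 3; 5]; [:: 0; 1; 4]; [:: 1; 2; 8]] [:: (0, 4); (1, 2); (1, 3);
    (1, 5); (2, 8); (3, 5)];
  Reduction [:: 1] [:: [:: 1; 3; 5]; [:: 0; 1; 4]; [:: 1; 2; 7]] [:: (0, 4); (1, 2); (1, 3);
    (1, 5); (2, 7); (3, 5)];
  Reduction [:: 0; 1] [:: [:: 1; 3; 5]; [:: 0; 5; 6]; [:: 0; 3; 4]; [:: 0; 1; 2]] [:: (0, 2);
    (0, 6); (1, 3); (1, 4); (1, 5); (3, 4); (3, 5); (5, 6)];
  Reduction [:: 0; 1] [:: [:: 1; 4; 5]; [:: 1; 2; 3]; [:: 0; 3; 5]; [:: 0; 2; 4]; [:: 1; 7; 8]]
    [:: (0, 1); (0, 6); (1, 7); (1, 8); (2, 3); (2, 4); (3, 4); (3, 5); (4, 5); (7, 8)];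
  Reduction [:: 0; 1] [:: [:: 1; 4; 5]; [:: 0; 5; 6]; [:: 0; 2; 4]; [:: 0; 1; 3]; [:: 1; 2; 8]]
    [:: (0, 3); (0, 6); (1, 2); (1, 3); (1, 4); (1, 5); (2, 4); (2, 8); (4, 5); (5, 6)];
  Reduction [:: 0; 1] [:: [:: 1; 4; 5]; [:: 1; 2; 3]; [:: 0; 3; 4]; [:: 0; 2; 5]; [:: 1; 7; 8]]
    [:: (0, 1); (0, 6); (1, 7); (1, 8); (2, 3); (2, 5); (3, 4); (3, 5); (4, 5); (7, 8)];
  Reduction [:: 0; 1] [:: [:: 1; 4; 5]; [:: 0; 5; 6]; [:: 0; 3; 4]; [:: 0; 1; 2]; [:: 2; 3; 5]]
    [:: (0, 1); (0, 6); (1, 7); (1, 8); (2, 3); (2, 5); (3, 4); (3, 5); (4, 5); (5, 6)];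
  Reduction [:: 0; 1] [:: [:: 1; 4; 5]; [:: 1; 2; 3]; [:: 0; 3; 4]; [:: 0; 2; 5]] [:: (0, 1);
    (0, 6); (1, 7); (1, 8); (2, 3); (2, 5); (3, 4); (4, 5)]].

Definition adj_6_7_4_tree : dtree := Branch 2 6 (Branch 3 6 (Branch 4 6 (Branch 5 6 (Branch 2 4
    (Branch 2 5 (Branch 4 5 (Branch 2 3 (Branch 3 5 (Branch 7 8 (Reduce 0) (Branch 2 8 (Reduce 1)
    (Branch 2 7 (Reduce 2) (Branch 3 8 (Reduce 3) (Branch 3 7 (Reduce 4) (Reduce 5))))))
    (Branch 3 4 (Reduce 6) (Path 0 4 3 5))) (Branch 3 4 (Branch 3 5 (Reduce 7) (Path 0 2 3 5))
    (Path 0 2 3 4))) (Branch 3 4 (Branch 3 5 (Branch 7 8 (Reduce 8) (Branch 4 8 (Reduce 9)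
    (Branch 4 7 (Reduce 10) (Branch 2 8 (Reduce 11) (Branch 2 7 (Reduce 12) (Reduce 13))))))
    (Path 0 3 5 4)) (Path 0 3 4 5))) (Branch 2 3 (Branch 3 5 (Branch 4 5 (Branch 7 8 (Reduce 14)
    (Branch 2 8 (Reduce 15) (Branch 2 7 (Reduce 2) (Branch 3 8 (Reduce 3) (Branch 3 7 (Reduce 4)
    (Reduce 5)))))) (Path 0 2 5 4)) (Path 0 2 5 3)) (Path 0 3 2 5))) (Branch 2 3 (Branch 2 5
    (Branch 3 4 (Branch 4 5 (Branch 7 8 (Reduce 16) (Branch 3 5 (Reduce 17) (Reduce 18)))
    (Path 0 2 4 5)) (Path 0 2 4 3)) (Path 0 4 2 5)) (Path 0 3 2 4))) (Path 0 1 6 5))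
    (Path 0 1 6 4)) (Path 0 1 6 3)) (Path 0 1 6 2).

(** In the three [exc] certificates 0 has degree 5 and 1 has degree 7; 2, 3, 4 are their common
    neighbours, 5 is the remaining neighbour of 0, and 6, 7, 8 are the remaining neighbours of 1.
    They exclude, in turn, a missing edge 23, a missing edge 26, and a vertex 6 missing both 7 and
    8. *)
Definition exc_common_reds : seq reduction := [::
  Reduction [:: 0; 1] [:: [:: 1; 3; 4]; [:: 0; 3; 5]; [:: 0; 1; 2]; [:: 1; 7; 8]; [:: 2; 4; 5]]
    [:: (1, 2); (1, 3); (1, 4); (1, 6); (2, 4); (2, 5); (3, 4); (3, 5); (4, 5); (7, 8)];
  Reduction [:: 0; 1] [:: [:: 1; 3; 4]; [:: 0; 3; 5]; [:: 0; 1; 2]; [:: 1; 6; 8]; [:: 2; 4; 5]]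
    [:: (1, 2); (1, 3); (1, 4); (1, 6); (2, 4); (2, 5); (3, 4); (3, 5); (4, 5); (6, 8)];
  Reduction [:: 1] [:: [:: 1; 3; 4]; [:: 0; 1; 2]; [:: 1; 6; 7]] [:: (0, 2); (1, 2); (1, 3);
    (1, 4); (3, 4); (6, 7)];
  Reduction [:: 0; 1] [:: [:: 1; 3; 4]; [:: 0; 3; 5]; [:: 0; 1; 2]; [:: 2; 4; 5]] [:: (1, 2);
    (1, 3); (1, 4); (2, 4); (2, 5); (3, 4); (3, 5); (4, 5)]].

Definition exc_common_tree : dtree := Branch 2 4 (Branch 2 5 (Branch 3 4 (Branch 3 5 (Branch 4 5
    (Branch 7 8 (Reduce 0) (Branch 6 8 (Reduce 1) (Branch 6 7 (Reduce 2) (Reduce 3))))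
    (Path 0 1 5 4)) (Path 0 2 3 5)) (Path 0 2 3 4)) (Path 0 3 2 5)) (Path 0 3 2 4).

Definition exc_private_reds : seq reduction := [::
  Reduction [:: 0; 1] [:: [:: 0; 4; 5]; [:: 1; 7; 8]; [:: 1; 3; 6]; [:: 1; 2; 4]; [:: 0; 2; 3]]
    [:: (0, 2); (0, 3); (1, 4); (1, 7); (1, 8); (2, 3); (2, 4); (3, 6); (4, 5); (7, 8)];
  Reduction [:: 0; 1] [:: [:: 1; 3; 6]; [:: 0; 4; 5]; [:: 0; 2; 3]; [:: 1; 4; 8]; [:: 1; 2; 7]]
    [:: (0, 2); (0, 3); (1, 4); (1, 7); (1, 8); (2, 3); (2, 7); (3, 6); (4, 5); (4, 8)];
  Reduction [:: 0; 1] [:: [:: 1; 3; 6]; [:: 0; 4; 5]; [:: 0; 1; 2]; [:: 1; 4; 7]; [:: 2; 3; 5]]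
    [:: (0, 4); (1, 2); (1, 3); (1, 6); (2, 3); (2, 5); (3, 5); (3, 6); (4, 5); (4, 7)];
  Reduction [:: 1] [:: [:: 1; 3; 6]; [:: 1; 2; 7]; [:: 0; 1; 4]] [:: (0, 4); (1, 2); (1, 3);
    (1, 6); (2, 7); (3, 6)];
  Reduction [:: 0; 1] [:: [:: 1; 3; 6]; [:: 0; 3; 5]; [:: 0; 1; 4]; [:: 1; 2; 8]] [:: (0, 2);
    (0, 4); (1, 3); (1, 4); (1, 6); (2, 8); (3, 5); (3, 6)];
  Reduction [:: 1] [:: [:: 1; 3; 6]; [:: 0; 1; 2]; [:: 1; 4; 8]] [:: (0, 2); (1, 3); (1, 4);
    (1, 6); (3, 6); (4, 8)];
  Reduction [:: 1] [:: [:: 1; 2; 4]; [:: 0; 1; 3]; [:: 1; 6; 8]] [:: (0, 1); (0, 3); (1, 3);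
    (1, 6); (2, 4); (6, 8)];
  Reduction [:: 1] [:: [:: 1; 3; 8]; [:: 1; 2; 4]; [:: 1; 6; 7]] [:: (0, 1); (1, 3); (1, 4);
    (2, 4); (3, 8); (6, 7)];
  Reduction [:: 1] [:: [:: 1; 3; 8]; [:: 0; 1; 2]] [:: (0, 2); (1, 3); (1, 4); (3, 8)];
  Reduction [:: 0; 1] [:: [:: 1; 2; 4]; [:: 0; 4; 5]; [:: 0; 2; 3]; [:: 1; 6; 8]; [:: 1; 3; 7]]
    [:: (0, 2); (0, 3); (1, 4); (1, 7); (1, 8); (2, 3); (2, 4); (3, 7); (4, 5); (6, 8)];
  Reduction [:: 0; 1] [:: [:: 1; 3; 7]; [:: 0; 3; 5]; [:: 0; 1; 4]; [:: 1; 2; 8]] [:: (0, 2);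
    (0, 4); (1, 3); (1, 4); (1, 7); (2, 8); (3, 5); (3, 7)];
  Reduction [:: 1] [:: [:: 1; 3; 7]; [:: 0; 1; 2]; [:: 1; 4; 8]] [:: (0, 2); (1, 3); (1, 4);
    (1, 7); (3, 7); (4, 8)];
  Reduction [:: 1] [:: [:: 1; 3; 7]; [:: 0; 1; 2]; [:: 1; 4; 6]] [:: (0, 2); (1, 3); (1, 4);
    (1, 7); (3, 7); (4, 6)];
  Reduction [:: 1] [:: [:: 1; 6; 7]; [:: 1; 2; 4]; [:: 0; 1; 3]] [:: (0, 1); (0, 3); (1, 3);
    (1, 7); (2, 4); (6, 7)];
  Reduction [:: 1] [:: [:: 1; 2; 4]; [:: 0; 1; 3]; [:: 1; 6; 7]] [:: (0, 3); (1, 2); (1, 4);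
    (1, 8); (2, 4); (6, 7)];
  Reduction [:: 1] [:: [:: 1; 2; 4]; [:: 0; 1; 3]; [:: 1; 7; 8]] [:: (0, 3); (1, 2); (1, 4);
    (1, 8); (2, 4); (7, 8)];
  Reduction [:: 1] [:: [:: 1; 2; 4]; [:: 0; 1; 3]; [:: 1; 6; 8]] [:: (0, 3); (1, 2); (1, 3);
    (1, 4); (2, 4); (6, 8)];
  Reduction [:: 1] [:: [:: 1; 4; 6]; [:: 0; 1; 3]; [:: 1; 2; 8]] [:: (0, 3); (1, 2); (1, 3);
    (1, 4); (2, 8); (4, 6)];
  Reduction [:: 1] [:: [:: 1; 4; 6]; [:: 0; 1; 3]; [:: 1; 2; 7]] [:: (0, 1); (0, 3); (1, 3);
    (1, 4); (2, 7); (4, 6)];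
  Reduction [:: 1] [:: [:: 1; 4; 7]; [:: 0; 1; 2]] [:: (0, 2); (1, 3); (1, 4); (4, 7)];
  Reduction [:: 0; 1] [:: [:: 1; 3; 4]; [:: 0; 4; 5]; [:: 0; 1; 2]; [:: 1; 7; 8]; [:: 2; 3; 5]]
    [:: (1, 2); (1, 3); (1, 4); (1, 6); (2, 3); (2, 5); (3, 4); (3, 5); (4, 5); (7, 8)];
  Reduction [:: 0; 1] [:: [:: 1; 3; 4]; [:: 0; 4; 5]; [:: 0; 1; 2]; [:: 1; 6; 8]; [:: 2; 3; 5]]
    [:: (1, 2); (1, 3); (1, 4); (1, 7); (2, 3); (2, 5); (3, 4); (3, 5); (4, 5); (6, 8)];
  Reduction [:: 1] [:: [:: 1; 3; 4]; [:: 0; 1; 2]; [:: 1; 6; 7]] [:: (0, 2); (1, 2); (1, 3);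
    (1, 4); (3, 4); (6, 7)];
  Reduction [:: 0; 1] [:: [:: 1; 3; 4]; [:: 0; 4; 5]; [:: 0; 1; 2]; [:: 2; 3; 5]] [:: (1, 2);
    (1, 3); (1, 4); (2, 3); (2, 5); (3, 4); (3, 5); (4, 5)];
  Reduction [:: 0; 1] [:: [:: 1; 3; 4]; [:: 0; 3; 5]; [:: 0; 1; 2]; [:: 1; 7; 8]; [:: 2; 4; 5]]
    [:: (1, 2); (1, 3); (1, 4); (1, 6); (2, 4); (2, 5); (3, 4); (3, 5); (4, 5); (7, 8)];
  Reduction [:: 0; 1] [:: [:: 1; 3; 4]; [:: 0; 3; 5]; [:: 0; 1; 2]; [:: 1; 6; 8]; [:: 2; 4; 5]]
    [:: (1, 2); (1, 3); (1, 4); (1, 7); (2, 4); (2, 5); (3, 4); (3, 5); (4, 5); (6, 8)];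
  Reduction [:: 0; 1] [:: [:: 1; 3; 4]; [:: 0; 3; 5]; [:: 0; 1; 2]; [:: 2; 4; 5]] [:: (1, 2);
    (1, 3); (1, 4); (2, 4); (2, 5); (3, 4); (3, 5); (4, 5)]].

Definition exc_private_tree : dtree := Branch 2 5 (Branch 3 5 (Branch 4 5 (Branch 2 3 (Branch 2 4
    (Branch 3 6 (Branch 7 8 (Reduce 0) (Branch 2 7 (Branch 4 8 (Reduce 1) (Branch 4 7 (Reduce 2)
    (Reduce 3))) (Branch 2 8 (Reduce 4) (Branch 4 8 (Reduce 5) (Branch 4 7 (Reduce 2) (Branch 6 8
    (Reduce 6) (Branch 3 8 (Branch 6 7 (Reduce 7) (Branch 3 7 (Reduce 8) (Isolated 1 7)))
    (Isolated 1 8)))))))) (Branch 3 7 (Branch 6 8 (Reduce 9) (Branch 2 8 (Reduce 10) (Branch 4 8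
    (Reduce 11) (Branch 4 6 (Reduce 12) (Branch 6 7 (Reduce 13) (Isolated 1 6)))))) (Branch 6 7
    (Reduce 14) (Branch 7 8 (Reduce 15) (Branch 6 8 (Reduce 16) (Branch 4 6 (Branch 2 8 (Reduce 17)
    (Branch 2 7 (Reduce 18) (Branch 4 7 (Reduce 19) (Isolated 1 7)))) (Isolated 1 6)))))))
    (Branch 3 4 (Branch 7 8 (Reduce 20) (Branch 6 8 (Reduce 21) (Branch 6 7 (Reduce 22)
    (Reduce 23)))) (Path 0 2 4 3))) (Branch 2 4 (Branch 3 4 (Branch 7 8 (Reduce 24) (Branch 6 8
    (Reduce 25) (Branch 6 7 (Reduce 22) (Reduce 26)))) (Path 0 2 3 4)) (Path 0 3 2 4)))
    (Path 0 1 5 4)) (Path 0 1 5 3)) (Path 0 1 5 2).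

Definition exc_pendant_reds : seq reduction := [::
  Reduction [:: 1] [:: [:: 0; 1; 4]; [:: 1; 7; 8]; [:: 1; 3; 6]] [:: (0, 4); (1, 2); (1, 3);
    (1, 4); (3, 6); (7, 8)];
  Reduction [:: 1] [:: [:: 1; 3; 6]; [:: 0; 1; 4]; [:: 1; 2; 8]] [:: (0, 4); (1, 2); (1, 3);
    (1, 4); (2, 8); (3, 6)];
  Reduction [:: 1] [:: [:: 1; 3; 6]; [:: 0; 1; 4]; [:: 1; 2; 7]] [:: (0, 4); (1, 2); (1, 3);
    (1, 4); (2, 7); (3, 6)];
  Reduction [:: 1] [:: [:: 1; 3; 6]; [:: 0; 1; 2]; [:: 1; 4; 8]] [:: (0, 2); (1, 2); (1, 3);
    (1, 4); (3, 6); (4, 8)];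
  Reduction [:: 1] [:: [:: 1; 3; 8]; [:: 0; 1; 4]; [:: 1; 2; 6]] [:: (0, 1); (0, 4); (1, 3);
    (1, 4); (2, 6); (3, 8)];
  Reduction [:: 1] [:: [:: 1; 3; 8]; [:: 0; 1; 2]] [:: (0, 2); (1, 3); (1, 4); (3, 8)];
  Reduction [:: 1] [:: [:: 0; 1; 4]; [:: 1; 7; 8]; [:: 1; 2; 6]] [:: (0, 4); (1, 2); (1, 3);
    (1, 4); (2, 6); (7, 8)];
  Reduction [:: 1] [:: [:: 1; 2; 6]; [:: 0; 1; 4]; [:: 1; 3; 8]] [:: (0, 4); (1, 2); (1, 3);
    (1, 4); (2, 6); (3, 8)];
  Reduction [:: 1] [:: [:: 1; 2; 6]; [:: 0; 1; 4]; [:: 1; 3; 7]] [:: (0, 1); (0, 4); (1, 2);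
    (1, 4); (2, 6); (3, 7)];
  Reduction [:: 1] [:: [:: 1; 2; 6]; [:: 0; 1; 3]] [:: (0, 3); (1, 2); (1, 4); (2, 6)];
  Reduction [:: 1] [:: [:: 1; 4; 6]; [:: 0; 1; 3]; [:: 1; 7; 8]] [:: (0, 3); (1, 2); (1, 3);
    (1, 4); (4, 6); (7, 8)];
  Reduction [:: 1] [:: [:: 1; 4; 6]; [:: 0; 1; 3]; [:: 1; 2; 8]] [:: (0, 3); (1, 2); (1, 3);
    (1, 4); (2, 8); (4, 6)];
  Reduction [:: 1] [:: [:: 1; 4; 6]; [:: 0; 1; 3]; [:: 1; 2; 7]] [:: (0, 1); (0, 3); (1, 3);
    (1, 4); (2, 7); (4, 6)];
  Reduction [:: 1] [:: [:: 1; 4; 6]; [:: 0; 1; 2]] [:: (0, 2); (1, 3); (1, 4); (4, 6)]].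

Definition exc_pendant_tree : dtree := Branch 2 5 (Branch 3 5 (Branch 4 5 (Branch 3 6 (Branch 7 8
    (Reduce 0) (Branch 2 8 (Reduce 1) (Branch 2 7 (Reduce 2) (Branch 4 8 (Reduce 3) (Branch 3 8
    (Branch 2 6 (Reduce 4) (Reduce 5)) (Isolated 1 8)))))) (Branch 2 6 (Branch 7 8 (Reduce 6)
    (Branch 3 8 (Reduce 7) (Branch 3 7 (Reduce 8) (Reduce 9)))) (Branch 4 6 (Branch 7 8 (Reduce 10)
    (Branch 2 8 (Reduce 11) (Branch 2 7 (Reduce 12) (Reduce 13)))) (Isolated 1 6))))
    (Path 0 1 5 4)) (Path 0 1 5 3)) (Path 0 1 5 2).

Definition nine_reds : seq reduction := [::
  Reduction [:: 0] [:: [:: 0; 6; 9]; [:: 0; 5; 8]; [:: 0; 4; 7]] [:: (0, 7); (0, 8); (0, 9);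
    (4, 7); (5, 8); (6, 9)]].

Definition nine_tree : dtree := Branch 1 7 (Branch 1 8 (Branch 1 9 (Branch 2 7 (Branch 2 8
    (Branch 2 9 (Branch 3 7 (Branch 3 8 (Branch 3 9 (Branch 4 7 (Branch 4 8 (Branch 4 9 (Branch 5 7
    (Branch 5 8 (Branch 5 9 (Branch 6 7 (Branch 6 8 (Branch 6 9 (Reduce 0) (Few 0 6)) (Few 0 6))
    (Few 0 6)) (Few 0 5)) (Few 0 5)) (Few 0 5)) (Few 0 4)) (Few 0 4)) (Few 0 4)) (Few 0 3))
    (Few 0 3)) (Few 0 3)) (Few 0 2)) (Few 0 2)) (Few 0 2)) (Few 0 1)) (Few 0 1)) (Few 0 1).

Definition eight_reds : seq reduction := [::
  Reduction [:: 0] [:: [:: 0; 4; 8]; [:: 0; 3; 7]; [:: 0; 2; 6]; [:: 0; 1; 5]] [:: (0, 5); (0, 6);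
    (0, 7); (0, 8); (1, 5); (2, 6); (3, 7); (4, 8)];
  Reduction [:: 0] [:: [:: 0; 4; 7]; [:: 0; 2; 6]; [:: 0; 1; 5]; [:: 0; 3; 8]] [:: (0, 5); (0, 6);
    (0, 7); (0, 8); (1, 5); (2, 6); (3, 8); (4, 7)];
  Reduction [:: 0] [:: [:: 0; 4; 7]; [:: 0; 3; 6]; [:: 0; 1; 5]; [:: 0; 2; 8]] [:: (0, 1); (0, 5);
    (0, 6); (0, 7); (1, 5); (2, 8); (3, 6); (4, 7)];
  Reduction [:: 0] [:: [:: 0; 4; 7]; [:: 0; 3; 6]; [:: 0; 2; 5]; [:: 0; 1; 8]] [:: (0, 5); (0, 6);
    (0, 7); (1, 8); (2, 5); (3, 6); (4, 7)];
  Reduction [:: 0] [:: [:: 0; 4; 7]; [:: 0; 3; 6]; [:: 0; 2; 5]] [:: (0, 5); (0, 6); (0, 7);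
    (2, 5); (3, 6); (4, 7)];
  Reduction [:: 0] [:: [:: 0; 4; 8]; [:: 0; 3; 6]; [:: 0; 1; 5]; [:: 0; 2; 7]] [:: (0, 1); (0, 5);
    (0, 6); (0, 8); (1, 5); (2, 7); (3, 6); (4, 8)];
  Reduction [:: 0] [:: [:: 0; 4; 8]; [:: 0; 3; 6]; [:: 0; 2; 5]; [:: 0; 1; 7]] [:: (0, 5); (0, 6);
    (0, 8); (1, 7); (2, 5); (3, 6); (4, 8)];
  Reduction [:: 0] [:: [:: 0; 4; 8]; [:: 0; 3; 6]; [:: 0; 2; 5]] [:: (0, 5); (0, 6); (0, 8);
    (2, 5); (3, 6); (4, 8)];
  Reduction [:: 0] [:: [:: 0; 2; 8]; [:: 0; 1; 5]; [:: 0; 4; 7]; [:: 0; 3; 6]] [:: (0, 5); (0, 6);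
    (0, 7); (0, 8); (1, 5); (2, 8); (3, 6); (4, 7)];
  Reduction [:: 0] [:: [:: 0; 4; 8]; [:: 0; 3; 6]; [:: 0; 2; 7]; [:: 0; 1; 5]] [:: (0, 5); (0, 6);
    (0, 7); (0, 8); (1, 5); (2, 7); (3, 6); (4, 8)];
  Reduction [:: 0] [:: [:: 0; 3; 8]; [:: 0; 2; 7]; [:: 0; 1; 5]; [:: 0; 4; 6]] [:: (0, 1); (0, 5);
    (0, 7); (0, 8); (1, 5); (2, 7); (3, 8); (4, 6)];
  Reduction [:: 0] [:: [:: 0; 4; 8]; [:: 0; 3; 7]; [:: 0; 2; 5]; [:: 0; 1; 6]] [:: (0, 5); (0, 7);
    (0, 8); (1, 6); (2, 5); (3, 7); (4, 8)];
  Reduction [:: 0] [:: [:: 0; 4; 8]; [:: 0; 3; 7]; [:: 0; 2; 5]] [:: (0, 5); (0, 7); (0, 8);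
    (2, 5); (3, 7); (4, 8)];
  Reduction [:: 0] [:: [:: 0; 1; 8]; [:: 0; 4; 7]; [:: 0; 3; 6]; [:: 0; 2; 5]] [:: (0, 5); (0, 6);
    (0, 7); (0, 8); (1, 8); (2, 5); (3, 6); (4, 7)];
  Reduction [:: 0] [:: [:: 0; 4; 8]; [:: 0; 3; 6]; [:: 0; 2; 5]; [:: 0; 1; 7]] [:: (0, 5); (0, 6);
    (0, 7); (0, 8); (1, 7); (2, 5); (3, 6); (4, 8)];
  Reduction [:: 0] [:: [:: 0; 3; 8]; [:: 0; 2; 5]; [:: 0; 1; 7]; [:: 0; 4; 6]] [:: (0, 5); (0, 6);
    (0, 7); (0, 8); (1, 7); (2, 5); (3, 8); (4, 6)];
  Reduction [:: 0] [:: [:: 0; 4; 8]; [:: 0; 3; 7]; [:: 0; 2; 5]; [:: 0; 1; 6]] [:: (0, 2); (0, 5);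
    (0, 7); (0, 8); (1, 6); (2, 5); (3, 7); (4, 8)];
  Reduction [:: 0] [:: [:: 0; 2; 8]; [:: 0; 1; 7]; [:: 0; 4; 6]; [:: 0; 3; 5]] [:: (0, 4); (0, 6);
    (0, 7); (0, 8); (1, 7); (2, 8); (3, 5); (4, 6)];
  Reduction [:: 0] [:: [:: 0; 4; 8]; [:: 0; 3; 5]; [:: 0; 2; 7]; [:: 0; 1; 6]] [:: (0, 4); (0, 6);
    (0, 7); (0, 8); (1, 6); (2, 7); (3, 5); (4, 8)];
  Reduction [:: 0] [:: [:: 0; 3; 8]; [:: 0; 2; 7]; [:: 0; 1; 6]; [:: 0; 4; 5]] [:: (0, 6); (0, 7);
    (0, 8); (1, 6); (2, 7); (3, 8); (4, 5)];
  Reduction [:: 0] [:: [:: 0; 4; 8]; [:: 0; 3; 7]; [:: 0; 2; 6]] [:: (0, 6); (0, 7); (0, 8);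
    (2, 6); (3, 7); (4, 8)]].

Definition eight_tree : dtree := Branch 1 5 (Branch 2 6 (Branch 3 7 (Branch 4 8 (Reduce 0)
    (Branch 4 5 (Branch 4 6 (Branch 4 7 (Branch 3 8 (Reduce 1) (Branch 3 5 (Branch 3 6 (Branch 2 8
    (Reduce 2) (Branch 2 5 (Branch 2 7 (Branch 1 8 (Reduce 3) (Branch 1 6 (Branch 1 7 (Reduce 4)
    (Few 0 1)) (Few 0 1))) (Few 0 2)) (Few 0 2))) (Few 0 3)) (Few 0 3))) (Few 0 4)) (Few 0 4))
    (Few 0 4))) (Branch 3 5 (Branch 3 6 (Branch 3 8 (Branch 4 7 (Reduce 1) (Branch 4 5 (Branch 4 6
    (Branch 4 8 (Branch 2 7 (Reduce 5) (Branch 2 5 (Branch 2 8 (Branch 1 7 (Reduce 6) (Branch 1 6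
    (Branch 1 8 (Reduce 7) (Few 0 1)) (Few 0 1))) (Few 0 2)) (Few 0 2))) (Few 0 4)) (Few 0 4))
    (Few 0 4))) (Few 0 3)) (Few 0 3)) (Few 0 3))) (Branch 2 5 (Branch 2 7 (Branch 2 8 (Branch 3 6
    (Branch 4 7 (Reduce 8) (Branch 4 5 (Branch 4 6 (Branch 4 8 (Reduce 9) (Few 0 4)) (Few 0 4))
    (Few 0 4))) (Branch 3 5 (Branch 3 7 (Branch 3 8 (Branch 4 6 (Reduce 10) (Branch 4 5 (Branch 4 7
    (Branch 4 8 (Branch 1 6 (Reduce 11) (Branch 1 7 (Branch 1 8 (Reduce 12) (Few 0 1)) (Few 0 1)))
    (Few 0 4)) (Few 0 4)) (Few 0 4))) (Few 0 3)) (Few 0 3)) (Few 0 3))) (Few 0 2)) (Few 0 2))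
    (Few 0 2))) (Branch 1 6 (Branch 1 7 (Branch 1 8 (Branch 2 5 (Branch 3 6 (Branch 4 7 (Reduce 13)
    (Branch 4 5 (Branch 4 6 (Branch 4 8 (Reduce 14) (Few 0 4)) (Few 0 4)) (Few 0 4))) (Branch 3 5
    (Branch 3 7 (Branch 3 8 (Branch 4 6 (Reduce 15) (Branch 4 5 (Branch 4 7 (Branch 4 8 (Reduce 16)
    (Few 0 4)) (Few 0 4)) (Few 0 4))) (Few 0 3)) (Few 0 3)) (Few 0 3))) (Branch 2 6 (Branch 2 7
    (Branch 2 8 (Branch 3 5 (Branch 4 6 (Reduce 17) (Branch 4 5 (Branch 4 7 (Branch 4 8 (Reduce 18)
    (Few 0 4)) (Few 0 4)) (Few 0 4))) (Branch 3 6 (Branch 3 7 (Branch 3 8 (Branch 4 5 (Reduce 19)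
    (Branch 4 6 (Branch 4 7 (Branch 4 8 (Reduce 20) (Few 0 4)) (Few 0 4)) (Few 0 4))) (Few 0 3))
    (Few 0 3)) (Few 0 3))) (Few 0 2)) (Few 0 2)) (Few 0 2))) (Few 0 1)) (Few 0 1)) (Few 0 1)).

(** Here 0 has degree 8, its neighbours 1, 2, 3 are small, and 1 and 2 are assumed to miss the same
    further neighbour 4. *)
Definition shared_reds : seq reduction := [::
  Reduction [:: 0] [:: [:: 0; 7; 8]; [:: 0; 3; 4]; [:: 0; 2; 6]; [:: 0; 1; 5]] [:: (0, 5); (0, 6);
    (0, 7); (0, 8); (1, 5); (2, 6); (3, 4); (7, 8)];
  Reduction [:: 0] [:: [:: 0; 3; 4]; [:: 0; 2; 6]; [:: 0; 5; 8]; [:: 0; 1; 7]] [:: (0, 5); (0, 6);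
    (0, 7); (0, 8); (1, 7); (2, 6); (3, 4); (5, 8)];
  Reduction [:: 0] [:: [:: 0; 3; 4]; [:: 0; 1; 7]; [:: 0; 6; 8]; [:: 0; 2; 5]] [:: (0, 5); (0, 6);
    (0, 7); (0, 8); (1, 7); (2, 5); (3, 4); (6, 8)];
  Reduction [:: 0] [:: [:: 0; 2; 7]; [:: 0; 1; 6]; [:: 0; 4; 8]; [:: 0; 3; 5]] [:: (0, 3); (0, 5);
    (0, 6); (0, 7); (1, 6); (2, 7); (3, 5); (4, 8)];
  Reduction [:: 0] [:: [:: 0; 2; 7]; [:: 0; 1; 6]; [:: 0; 4; 5]; [:: 0; 3; 8]] [:: (0, 4); (0, 5);
    (0, 6); (0, 7); (1, 6); (2, 7); (3, 8); (4, 5)];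
  Reduction [:: 0] [:: [:: 0; 3; 8]; [:: 0; 2; 7]; [:: 0; 1; 5]; [:: 0; 4; 6]] [:: (0, 2); (0, 4);
    (0, 6); (0, 7); (1, 5); (2, 7); (3, 8); (4, 6)];
  Reduction [:: 0] [:: [:: 0; 3; 8]; [:: 0; 2; 6]; [:: 0; 1; 5]; [:: 0; 4; 7]] [:: (0, 2); (0, 4);
    (0, 6); (0, 7); (1, 5); (2, 6); (3, 8); (4, 7)];
  Reduction [:: 0] [:: [:: 0; 4; 8]; [:: 0; 3; 7]; [:: 0; 2; 6]; [:: 0; 1; 5]] [:: (0, 2); (0, 4);
    (0, 6); (0, 7); (1, 5); (2, 6); (3, 7); (4, 8)];
  Reduction [:: 0] [:: [:: 0; 6; 8]; [:: 0; 3; 4]; [:: 0; 2; 7]; [:: 0; 1; 5]] [:: (0, 5); (0, 6);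
    (0, 7); (0, 8); (1, 5); (2, 7); (3, 4); (6, 8)];
  Reduction [:: 0] [:: [:: 0; 3; 4]; [:: 0; 2; 6]; [:: 0; 5; 7]; [:: 0; 1; 8]] [:: (0, 5); (0, 6);
    (0, 7); (0, 8); (1, 8); (2, 6); (3, 4); (5, 7)];
  Reduction [:: 0] [:: [:: 0; 5; 8]; [:: 0; 3; 4]; [:: 0; 2; 7]; [:: 0; 1; 6]] [:: (0, 5); (0, 6);
    (0, 7); (0, 8); (1, 6); (2, 7); (3, 4); (5, 8)];
  Reduction [:: 0] [:: [:: 0; 3; 4]; [:: 0; 2; 8]; [:: 0; 1; 5]; [:: 0; 6; 7]] [:: (0, 5); (0, 6);
    (0, 7); (0, 8); (1, 5); (2, 8); (3, 4); (6, 7)];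
  Reduction [:: 0] [:: [:: 0; 2; 8]; [:: 0; 1; 6]; [:: 0; 4; 7]; [:: 0; 3; 5]] [:: (0, 3); (0, 5);
    (0, 6); (0, 8); (1, 6); (2, 8); (3, 5); (4, 7)];
  Reduction [:: 0] [:: [:: 0; 2; 8]; [:: 0; 1; 6]; [:: 0; 4; 5]; [:: 0; 3; 7]] [:: (0, 4); (0, 5);
    (0, 6); (0, 8); (1, 6); (2, 8); (3, 7); (4, 5)];
  Reduction [:: 0] [:: [:: 0; 3; 7]; [:: 0; 2; 8]; [:: 0; 1; 5]; [:: 0; 4; 6]] [:: (0, 2); (0, 4);
    (0, 6); (0, 8); (1, 5); (2, 8); (3, 7); (4, 6)];
  Reduction [:: 0] [:: [:: 0; 3; 7]; [:: 0; 2; 6]; [:: 0; 1; 5]; [:: 0; 4; 8]] [:: (0, 2); (0, 4);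
    (0, 6); (0, 8); (1, 5); (2, 6); (3, 7); (4, 8)];
  Reduction [:: 0] [:: [:: 0; 4; 7]; [:: 0; 3; 8]; [:: 0; 2; 6]; [:: 0; 1; 5]] [:: (0, 2); (0, 4);
    (0, 6); (0, 8); (1, 5); (2, 6); (3, 8); (4, 7)];
  Reduction [:: 0] [:: [:: 0; 2; 6]; [:: 0; 1; 5]; [:: 0; 4; 8]; [:: 0; 3; 7]] [:: (0, 5); (0, 6);
    (0, 7); (0, 8); (1, 5); (2, 6); (3, 7); (4, 8)];
  Reduction [:: 0] [:: [:: 0; 3; 7]; [:: 0; 2; 6]; [:: 0; 4; 5]; [:: 0; 1; 8]] [:: (0, 5); (0, 6);
    (0, 7); (0, 8); (1, 8); (2, 6); (3, 7); (4, 5)];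
  Reduction [:: 0] [:: [:: 0; 3; 7]; [:: 0; 1; 8]; [:: 0; 4; 6]; [:: 0; 2; 5]] [:: (0, 5); (0, 6);
    (0, 7); (0, 8); (1, 8); (2, 5); (3, 7); (4, 6)];
  Reduction [:: 0] [:: [:: 0; 4; 7]; [:: 0; 2; 6]; [:: 0; 1; 8]; [:: 0; 3; 5]] [:: (0, 5); (0, 6);
    (0, 7); (0, 8); (1, 8); (2, 6); (3, 5); (4, 7)];
  Reduction [:: 0] [:: [:: 0; 4; 7]; [:: 0; 3; 8]; [:: 0; 2; 6]; [:: 0; 1; 5]] [:: (0, 2); (0, 6);
    (0, 7); (0, 8); (1, 5); (2, 6); (3, 8); (4, 7)];
  Reduction [:: 0] [:: [:: 0; 3; 7]; [:: 0; 2; 8]; [:: 0; 1; 5]; [:: 0; 4; 6]] [:: (0, 3); (0, 6);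
    (0, 7); (0, 8); (1, 5); (2, 8); (3, 7); (4, 6)];
  Reduction [:: 0] [:: [:: 0; 3; 7]; [:: 0; 1; 6]; [:: 0; 4; 5]; [:: 0; 2; 8]] [:: (0, 3); (0, 5);
    (0, 6); (0, 7); (1, 6); (2, 8); (3, 7); (4, 5)];
  Reduction [:: 0] [:: [:: 0; 3; 7]; [:: 0; 2; 8]; [:: 0; 1; 5]; [:: 0; 4; 6]] [:: (0, 3); (0, 5);
    (0, 6); (0, 7); (1, 5); (2, 8); (3, 7); (4, 6)];
  Reduction [:: 0] [:: [:: 0; 4; 7]; [:: 0; 2; 8]; [:: 0; 1; 6]; [:: 0; 3; 5]] [:: (0, 3); (0, 5);
    (0, 6); (0, 7); (1, 6); (2, 8); (3, 5); (4, 7)];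
  Reduction [:: 0] [:: [:: 0; 2; 7]; [:: 0; 1; 6]; [:: 0; 3; 8]] [:: (0, 5); (0, 6); (0, 7);
    (1, 6); (2, 7); (3, 8)];
  Reduction [:: 0] [:: [:: 0; 3; 7]; [:: 0; 2; 6]; [:: 0; 1; 5]] [:: (0, 5); (0, 6); (0, 7);
    (1, 5); (2, 6); (3, 7)];
  Reduction [:: 0] [:: [:: 0; 3; 8]; [:: 0; 2; 6]; [:: 0; 1; 5]; [:: 0; 4; 7]] [:: (0, 5); (0, 6);
    (0, 7); (0, 8); (1, 5); (2, 6); (3, 8); (4, 7)];
  Reduction [:: 0] [:: [:: 0; 3; 8]; [:: 0; 2; 6]; [:: 0; 4; 5]; [:: 0; 1; 7]] [:: (0, 2); (0, 5);
    (0, 6); (0, 8); (1, 7); (2, 6); (3, 8); (4, 5)];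
  Reduction [:: 0] [:: [:: 0; 3; 5]; [:: 0; 2; 6]; [:: 0; 1; 7]; [:: 0; 4; 8]] [:: (0, 2); (0, 5);
    (0, 6); (0, 8); (1, 7); (2, 6); (3, 5); (4, 8)];
  Reduction [:: 0] [:: [:: 0; 4; 6]; [:: 0; 3; 8]; [:: 0; 1; 7]; [:: 0; 2; 5]] [:: (0, 2); (0, 5);
    (0, 6); (0, 8); (1, 7); (2, 5); (3, 8); (4, 6)];
  Reduction [:: 0] [:: [:: 0; 4; 6]; [:: 0; 3; 8]; [:: 0; 2; 7]; [:: 0; 1; 5]] [:: (0, 1); (0, 5);
    (0, 6); (0, 8); (1, 5); (2, 7); (3, 8); (4, 6)];
  Reduction [:: 0] [:: [:: 0; 3; 8]; [:: 0; 1; 6]; [:: 0; 2; 7]] [:: (0, 5); (0, 6); (0, 8);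
    (1, 6); (2, 7); (3, 8)];
  Reduction [:: 0] [:: [:: 0; 3; 8]; [:: 0; 2; 6]; [:: 0; 1; 5]] [:: (0, 5); (0, 6); (0, 8);
    (1, 5); (2, 6); (3, 8)];
  Reduction [:: 0] [:: [:: 0; 3; 4]; [:: 0; 1; 7]; [:: 0; 5; 6]; [:: 0; 2; 8]] [:: (0, 5); (0, 6);
    (0, 7); (0, 8); (1, 7); (2, 8); (3, 4); (5, 6)];
  Reduction [:: 0] [:: [:: 0; 7; 8]; [:: 0; 3; 4]; [:: 0; 2; 5]; [:: 0; 1; 6]] [:: (0, 5); (0, 6);
    (0, 7); (0, 8); (1, 6); (2, 5); (3, 4); (7, 8)];
  Reduction [:: 0] [:: [:: 0; 2; 8]; [:: 0; 1; 7]; [:: 0; 4; 6]; [:: 0; 3; 5]] [:: (0, 3); (0, 5);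
    (0, 7); (0, 8); (1, 7); (2, 8); (3, 5); (4, 6)];
  Reduction [:: 0] [:: [:: 0; 2; 8]; [:: 0; 1; 7]; [:: 0; 4; 5]; [:: 0; 3; 6]] [:: (0, 4); (0, 5);
    (0, 7); (0, 8); (1, 7); (2, 8); (3, 6); (4, 5)];
  Reduction [:: 0] [:: [:: 0; 3; 6]; [:: 0; 2; 8]; [:: 0; 1; 5]; [:: 0; 4; 7]] [:: (0, 2); (0, 4);
    (0, 7); (0, 8); (1, 5); (2, 8); (3, 6); (4, 7)];
  Reduction [:: 0] [:: [:: 0; 3; 6]; [:: 0; 2; 7]; [:: 0; 1; 5]; [:: 0; 4; 8]] [:: (0, 2); (0, 4);
    (0, 7); (0, 8); (1, 5); (2, 7); (3, 6); (4, 8)];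
  Reduction [:: 0] [:: [:: 0; 4; 6]; [:: 0; 3; 8]; [:: 0; 2; 7]; [:: 0; 1; 5]] [:: (0, 2); (0, 4);
    (0, 7); (0, 8); (1, 5); (2, 7); (3, 8); (4, 6)];
  Reduction [:: 0] [:: [:: 0; 2; 8]; [:: 0; 1; 5]; [:: 0; 4; 7]; [:: 0; 3; 6]] [:: (0, 5); (0, 6);
    (0, 7); (0, 8); (1, 5); (2, 8); (3, 6); (4, 7)];
  Reduction [:: 0] [:: [:: 0; 3; 6]; [:: 0; 2; 7]; [:: 0; 1; 5]; [:: 0; 4; 8]] [:: (0, 5); (0, 6);
    (0, 7); (0, 8); (1, 5); (2, 7); (3, 6); (4, 8)];
  Reduction [:: 0] [:: [:: 0; 3; 6]; [:: 0; 2; 8]; [:: 0; 4; 5]; [:: 0; 1; 7]] [:: (0, 5); (0, 6);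
    (0, 7); (0, 8); (1, 7); (2, 8); (3, 6); (4, 5)];
  Reduction [:: 0] [:: [:: 0; 4; 6]; [:: 0; 2; 8]; [:: 0; 1; 7]; [:: 0; 3; 5]] [:: (0, 5); (0, 6);
    (0, 7); (0, 8); (1, 7); (2, 8); (3, 5); (4, 6)];
  Reduction [:: 0] [:: [:: 0; 4; 6]; [:: 0; 3; 8]; [:: 0; 2; 7]; [:: 0; 1; 5]] [:: (0, 2); (0, 6);
    (0, 7); (0, 8); (1, 5); (2, 7); (3, 8); (4, 6)];
  Reduction [:: 0] [:: [:: 0; 3; 6]; [:: 0; 2; 7]; [:: 0; 1; 8]; [:: 0; 4; 5]] [:: (0, 3); (0, 5);
    (0, 6); (0, 8); (1, 8); (2, 7); (3, 6); (4, 5)];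
  Reduction [:: 0] [:: [:: 0; 3; 8]; [:: 0; 2; 7]; [:: 0; 1; 5]; [:: 0; 4; 6]] [:: (0, 1); (0, 5);
    (0, 7); (0, 8); (1, 5); (2, 7); (3, 8); (4, 6)];
  Reduction [:: 0] [:: [:: 0; 3; 8]; [:: 0; 2; 7]; [:: 0; 1; 6]] [:: (0, 5); (0, 7); (0, 8);
    (1, 6); (2, 7); (3, 8)];
  Reduction [:: 0] [:: [:: 0; 3; 8]; [:: 0; 2; 7]; [:: 0; 1; 5]] [:: (0, 5); (0, 7); (0, 8);
    (1, 5); (2, 7); (3, 8)];
  Reduction [:: 0] [:: [:: 0; 4; 5]; [:: 0; 3; 8]; [:: 0; 2; 6]; [:: 0; 1; 7]] [:: (0, 5); (0, 6);
    (0, 7); (0, 8); (1, 7); (2, 6); (3, 8); (4, 5)];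
  Reduction [:: 0] [:: [:: 0; 3; 5]; [:: 0; 2; 6]; [:: 0; 1; 7]; [:: 0; 4; 8]] [:: (0, 2); (0, 6);
    (0, 7); (0, 8); (1, 7); (2, 6); (3, 5); (4, 8)];
  Reduction [:: 0] [:: [:: 0; 4; 6]; [:: 0; 3; 5]; [:: 0; 2; 7]; [:: 0; 1; 8]] [:: (0, 3); (0, 5);
    (0, 6); (0, 7); (1, 8); (2, 7); (3, 5); (4, 6)];
  Reduction [:: 0] [:: [:: 0; 3; 8]; [:: 0; 1; 7]; [:: 0; 2; 5]] [:: (0, 6); (0, 7); (0, 8);
    (1, 7); (2, 5); (3, 8)];
  Reduction [:: 0] [:: [:: 0; 5; 8]; [:: 0; 3; 7]; [:: 0; 2; 6]] [:: (0, 6); (0, 7); (0, 8);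
    (2, 6); (3, 7); (5, 8)];
  Reduction [:: 0] [:: [:: 0; 2; 8]; [:: 0; 1; 6]; [:: 0; 4; 7]; [:: 0; 3; 5]] [:: (0, 3); (0, 5);
    (0, 7); (0, 8); (1, 6); (2, 8); (3, 5); (4, 7)];
  Reduction [:: 0] [:: [:: 0; 4; 8]; [:: 0; 3; 5]; [:: 0; 2; 7]; [:: 0; 1; 6]] [:: (0, 3); (0, 5);
    (0, 7); (0, 8); (1, 6); (2, 7); (3, 5); (4, 8)];
  Reduction [:: 0] [:: [:: 0; 5; 7]; [:: 0; 3; 8]; [:: 0; 2; 6]] [:: (0, 6); (0, 7); (0, 8);
    (2, 6); (3, 8); (5, 7)];
  Reduction [:: 0] [:: [:: 0; 4; 6]; [:: 0; 3; 8]; [:: 0; 2; 5]; [:: 0; 1; 7]] [:: (0, 5); (0, 6);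
    (0, 7); (0, 8); (1, 7); (2, 5); (3, 8); (4, 6)];
  Reduction [:: 0] [:: [:: 0; 2; 5]; [:: 0; 1; 8]; [:: 0; 4; 7]; [:: 0; 3; 6]] [:: (0, 5); (0, 6);
    (0, 7); (0, 8); (1, 8); (2, 5); (3, 6); (4, 7)];
  Reduction [:: 0] [:: [:: 0; 3; 6]; [:: 0; 2; 5]; [:: 0; 1; 7]; [:: 0; 4; 8]] [:: (0, 5); (0, 6);
    (0, 7); (0, 8); (1, 7); (2, 5); (3, 6); (4, 8)];
  Reduction [:: 0] [:: [:: 0; 4; 5]; [:: 0; 3; 6]; [:: 0; 2; 7]; [:: 0; 1; 8]] [:: (0, 2); (0, 3);
    (0, 6); (0, 7); (1, 8); (2, 7); (3, 6); (4, 5)];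
  Reduction [:: 0] [:: [:: 0; 2; 8]; [:: 0; 1; 7]; [:: 0; 3; 5]] [:: (0, 6); (0, 7); (0, 8);
    (1, 7); (2, 8); (3, 5)];
  Reduction [:: 0] [:: [:: 0; 5; 6]; [:: 0; 3; 8]; [:: 0; 2; 7]] [:: (0, 6); (0, 7); (0, 8);
    (2, 7); (3, 8); (5, 6)];
  Reduction [:: 0] [:: [:: 0; 2; 8]; [:: 0; 1; 7]; [:: 0; 4; 6]; [:: 0; 3; 5]] [:: (0, 4); (0, 6);
    (0, 7); (0, 8); (1, 7); (2, 8); (3, 5); (4, 6)];
  Reduction [:: 0] [:: [:: 0; 3; 5]; [:: 0; 2; 8]; [:: 0; 1; 6]; [:: 0; 4; 7]] [:: (0, 4); (0, 6);
    (0, 7); (0, 8); (1, 6); (2, 8); (3, 5); (4, 7)];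
  Reduction [:: 0] [:: [:: 0; 3; 5]; [:: 0; 2; 7]; [:: 0; 1; 6]; [:: 0; 4; 8]] [:: (0, 4); (0, 6);
    (0, 7); (0, 8); (1, 6); (2, 7); (3, 5); (4, 8)];
  Reduction [:: 0] [:: [:: 0; 2; 8]; [:: 0; 1; 6]; [:: 0; 4; 5]; [:: 0; 3; 7]] [:: (0, 2); (0, 3);
    (0, 7); (0, 8); (1, 6); (2, 8); (3, 7); (4, 5)];
  Reduction [:: 0] [:: [:: 0; 4; 5]; [:: 0; 2; 8]; [:: 0; 1; 7]; [:: 0; 3; 6]] [:: (0, 3); (0, 6);
    (0, 7); (0, 8); (1, 7); (2, 8); (3, 6); (4, 5)];
  Reduction [:: 0] [:: [:: 0; 4; 5]; [:: 0; 3; 8]; [:: 0; 2; 7]; [:: 0; 1; 6]] [:: (0, 2); (0, 4);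
    (0, 7); (0, 8); (1, 6); (2, 7); (3, 8); (4, 5)]].

Definition shared_tree : dtree := Branch 1 5 (Branch 2 6 (Branch 3 4 (Branch 7 8 (Reduce 0)
    (Branch 1 7 (Branch 5 8 (Reduce 1) (Branch 1 8 (Path 1 5 8 7) (Branch 1 6 (Branch 2 5
    (Branch 6 8 (Reduce 2) (Branch 2 8 (Path 2 5 8 6) (Branch 2 7 (Branch 3 5 (Branch 4 8
    (Reduce 3) (Branch 3 8 (Path 3 4 8 5) (Isolated 0 8))) (Branch 3 8 (Branch 4 5 (Reduce 4)
    (Branch 4 6 (Reduce 5) (Branch 4 7 (Reduce 6) (Branch 3 6 (Path 3 4 6 8) (Branch 3 7
    (Path 3 4 7 8) (Few 0 3)))))) (Branch 3 6 (Branch 3 7 (Branch 4 8 (Reduce 7) (Isolated 0 8))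
    (Few 0 3)) (Few 0 3)))) (Few 0 2)))) (Branch 2 7 (Branch 2 8 (Branch 6 7 (Branch 6 8 (Reduce 8)
    (Path 2 6 8 7)) (Path 2 6 7 8)) (Few 0 2)) (Few 0 2))) (Few 0 1)))) (Branch 1 6 (Branch 1 8
    (Branch 5 7 (Reduce 9) (Branch 2 7 (Branch 6 8 (Reduce 8) (Branch 5 6 (Branch 5 8 (Reduce 10)
    (Path 1 5 8 6)) (Path 1 5 6 8))) (Branch 2 5 (Branch 2 8 (Branch 6 7 (Reduce 11) (Branch 3 5
    (Branch 4 7 (Reduce 12) (Branch 3 7 (Path 3 4 7 5) (Isolated 0 7))) (Branch 3 7 (Branch 4 5
    (Reduce 13) (Branch 4 6 (Reduce 14) (Branch 4 8 (Reduce 15) (Branch 3 6 (Path 3 4 6 7)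
    (Branch 3 8 (Path 3 4 8 7) (Few 0 3)))))) (Branch 3 6 (Branch 3 8 (Branch 4 7 (Reduce 16)
    (Isolated 0 7)) (Few 0 3)) (Few 0 3))))) (Few 0 2)) (Few 0 2)))) (Few 0 1)) (Few 0 1))))
    (Branch 3 7 (Branch 4 8 (Reduce 17) (Branch 1 8 (Branch 4 5 (Reduce 18) (Branch 2 5 (Branch 4 6
    (Reduce 19) (Branch 4 7 (Branch 3 5 (Reduce 20) (Branch 3 6 (Branch 3 8 (Reduce 21) (Few 0 3))
    (Few 0 3))) (Isolated 0 4))) (Branch 2 7 (Branch 2 8 (Branch 4 6 (Reduce 22) (Branch 4 7
    (Branch 3 5 (Reduce 20) (Branch 3 6 (Branch 3 8 (Reduce 21) (Few 0 3)) (Few 0 3)))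
    (Isolated 0 4))) (Few 0 2)) (Few 0 2)))) (Branch 1 6 (Branch 1 7 (Branch 2 8 (Branch 4 5
    (Reduce 23) (Branch 4 6 (Reduce 24) (Branch 4 7 (Branch 3 5 (Reduce 25) (Branch 3 6 (Branch 3 8
    (Reduce 21) (Few 0 3)) (Few 0 3))) (Isolated 0 4)))) (Branch 2 5 (Branch 2 7 (Branch 3 8
    (Reduce 26) (Branch 3 5 (Branch 3 6 (Reduce 27) (Few 0 3)) (Few 0 3))) (Few 0 2)) (Few 0 2)))
    (Few 0 1)) (Few 0 1)))) (Branch 3 5 (Branch 3 6 (Branch 3 8 (Branch 4 7 (Reduce 28) (Branch 1 7
    (Branch 4 5 (Reduce 29) (Branch 4 8 (Reduce 30) (Branch 4 6 (Branch 2 5 (Reduce 31) (Branch 2 7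
    (Branch 2 8 (Reduce 32) (Few 0 2)) (Few 0 2))) (Isolated 0 4)))) (Branch 1 6 (Branch 1 8
    (Branch 2 7 (Reduce 33) (Branch 2 5 (Branch 2 8 (Reduce 34) (Few 0 2)) (Few 0 2))) (Few 0 1))
    (Few 0 1)))) (Few 0 3)) (Few 0 3)) (Few 0 3)))) (Branch 2 5 (Branch 2 7 (Branch 2 8 (Branch 3 4
    (Branch 6 8 (Reduce 8) (Branch 6 7 (Reduce 11) (Branch 5 6 (Branch 1 7 (Reduce 35) (Branch 1 6
    (Branch 1 8 (Branch 5 8 (Reduce 10) (Path 1 5 8 6)) (Few 0 1)) (Few 0 1))) (Branch 1 6
    (Branch 5 8 (Reduce 10) (Branch 5 7 (Branch 7 8 (Reduce 36) (Path 2 5 8 7)) (Path 2 7 5 8)))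
    (Branch 1 7 (Branch 1 8 (Branch 3 5 (Branch 4 6 (Reduce 37) (Branch 3 6 (Path 3 4 6 5)
    (Isolated 0 6))) (Branch 3 6 (Branch 4 5 (Reduce 38) (Branch 4 7 (Reduce 39) (Branch 4 8
    (Reduce 40) (Branch 3 7 (Path 3 4 7 6) (Branch 3 8 (Path 3 4 8 6) (Few 0 3)))))) (Branch 3 7
    (Branch 3 8 (Branch 4 6 (Reduce 41) (Isolated 0 6)) (Few 0 3)) (Few 0 3)))) (Few 0 1))
    (Few 0 1)))))) (Branch 3 6 (Branch 4 7 (Reduce 42) (Branch 4 8 (Reduce 43) (Branch 1 7
    (Branch 4 5 (Reduce 44) (Branch 4 6 (Branch 3 5 (Reduce 45) (Branch 3 7 (Branch 3 8 (Reduce 46)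
    (Few 0 3)) (Few 0 3))) (Isolated 0 4))) (Branch 1 6 (Branch 1 8 (Branch 4 5 (Reduce 47)
    (Branch 4 6 (Branch 3 7 (Reduce 19) (Branch 3 5 (Branch 3 8 (Reduce 32) (Few 0 3)) (Few 0 3)))
    (Isolated 0 4))) (Few 0 1)) (Few 0 1))))) (Branch 3 5 (Branch 3 7 (Branch 3 8 (Branch 4 6
    (Reduce 48) (Branch 1 6 (Reduce 49) (Branch 1 7 (Branch 1 8 (Reduce 50) (Few 0 1)) (Few 0 1))))
    (Few 0 3)) (Few 0 3)) (Few 0 3)))) (Few 0 2)) (Few 0 2)) (Few 0 2))) (Branch 1 6 (Branch 1 7
    (Branch 1 8 (Branch 5 8 (Branch 2 6 (Branch 3 4 (Reduce 1) (Branch 4 5 (Branch 3 7 (Reduce 18)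
    (Branch 3 5 (Branch 3 6 (Branch 3 8 (Reduce 51) (Few 0 3)) (Few 0 3)) (Few 0 3))) (Branch 3 5
    (Branch 4 7 (Reduce 20) (Branch 4 8 (Reduce 52) (Branch 4 6 (Branch 2 8 (Reduce 45) (Branch 2 5
    (Branch 2 7 (Reduce 53) (Few 0 2)) (Few 0 2))) (Isolated 0 4)))) (Branch 3 6 (Branch 3 7
    (Branch 3 8 (Branch 2 5 (Reduce 54) (Branch 2 7 (Branch 2 8 (Reduce 55) (Few 0 2)) (Few 0 2)))
    (Few 0 3)) (Few 0 3)) (Few 0 3))))) (Branch 2 5 (Branch 2 7 (Branch 2 8 (Branch 3 4 (Reduce 10)
    (Branch 4 6 (Branch 3 7 (Reduce 19) (Branch 3 5 (Branch 3 6 (Branch 3 8 (Reduce 45) (Few 0 3))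
    (Few 0 3)) (Few 0 3))) (Branch 4 5 (Branch 3 6 (Reduce 44) (Branch 3 5 (Branch 3 7 (Branch 3 8
    (Reduce 49) (Few 0 3)) (Few 0 3)) (Few 0 3))) (Branch 3 5 (Branch 4 7 (Reduce 56) (Branch 4 8
    (Reduce 57) (Isolated 0 4))) (Branch 3 6 (Branch 3 7 (Branch 3 8 (Reduce 54) (Few 0 3))
    (Few 0 3)) (Few 0 3)))))) (Few 0 2)) (Few 0 2)) (Few 0 2))) (Branch 5 7 (Branch 2 6 (Branch 3 4
    (Reduce 9) (Branch 4 5 (Branch 3 7 (Reduce 18) (Branch 3 5 (Branch 3 6 (Branch 3 8 (Branch 5 6
    (Branch 6 8 (Reduce 51) (Path 3 5 8 6)) (Path 3 6 5 8)) (Few 0 3)) (Few 0 3)) (Few 0 3)))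
    (Branch 3 5 (Branch 4 7 (Reduce 20) (Branch 4 8 (Reduce 52) (Branch 4 6 (Branch 2 8 (Reduce 45)
    (Branch 2 5 (Branch 2 7 (Reduce 53) (Few 0 2)) (Few 0 2))) (Isolated 0 4)))) (Branch 3 6
    (Branch 3 7 (Branch 3 8 (Branch 2 5 (Reduce 54) (Branch 2 7 (Branch 2 8 (Reduce 58) (Few 0 2))
    (Few 0 2))) (Few 0 3)) (Few 0 3)) (Few 0 3))))) (Branch 2 5 (Branch 2 7 (Branch 2 8 (Branch 7 8
    (Branch 3 4 (Reduce 36) (Branch 4 6 (Branch 3 7 (Reduce 19) (Branch 3 5 (Branch 3 6 (Branch 3 8
    (Branch 5 6 (Branch 6 8 (Reduce 45) (Path 3 5 8 6)) (Path 3 6 5 8)) (Few 0 3)) (Few 0 3))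
    (Few 0 3))) (Branch 4 5 (Branch 3 6 (Reduce 44) (Branch 3 5 (Branch 3 7 (Branch 3 8 (Reduce 49)
    (Few 0 3)) (Few 0 3)) (Few 0 3))) (Branch 3 5 (Branch 4 7 (Reduce 56) (Branch 4 8 (Reduce 57)
    (Isolated 0 4))) (Branch 3 6 (Branch 3 7 (Branch 3 8 (Reduce 54) (Few 0 3)) (Few 0 3))
    (Few 0 3)))))) (Path 2 5 8 7)) (Few 0 2)) (Few 0 2)) (Few 0 2))) (Branch 2 5 (Branch 6 8
    (Branch 3 4 (Reduce 2) (Branch 4 6 (Branch 3 7 (Reduce 19) (Branch 3 5 (Branch 3 6 (Branch 3 8
    (Branch 5 6 (Reduce 59) (Path 3 6 5 8)) (Few 0 3)) (Few 0 3)) (Few 0 3))) (Branch 3 6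
    (Branch 4 7 (Reduce 60) (Branch 4 8 (Reduce 61) (Branch 4 5 (Branch 2 8 (Reduce 44) (Branch 2 6
    (Branch 2 7 (Branch 5 6 (Branch 6 7 (Reduce 62) (Path 2 5 7 6)) (Path 2 6 5 7)) (Few 0 2))
    (Few 0 2))) (Isolated 0 4)))) (Branch 3 5 (Branch 3 7 (Branch 3 8 (Path 3 7 5 8) (Few 0 3))
    (Few 0 3)) (Few 0 3))))) (Branch 6 7 (Branch 7 8 (Branch 3 4 (Reduce 36) (Branch 4 6
    (Branch 3 7 (Reduce 19) (Branch 3 5 (Branch 3 6 (Branch 3 8 (Path 3 5 8 6) (Few 0 3))
    (Few 0 3)) (Few 0 3))) (Branch 3 6 (Branch 4 7 (Reduce 60) (Branch 4 8 (Reduce 61) (Branch 4 5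
    (Branch 2 8 (Reduce 44) (Branch 2 6 (Branch 2 7 (Branch 5 6 (Reduce 62) (Path 2 6 5 7))
    (Few 0 2)) (Few 0 2))) (Isolated 0 4)))) (Branch 3 5 (Branch 3 7 (Branch 3 8 (Path 3 7 5 8)
    (Few 0 3)) (Few 0 3)) (Few 0 3))))) (Path 1 6 8 7)) (Path 1 7 6 8))) (Branch 2 6 (Branch 2 7
    (Branch 2 8 (Branch 5 6 (Branch 3 4 (Reduce 35) (Branch 4 5 (Branch 3 7 (Reduce 18) (Branch 3 5
    (Branch 3 6 (Branch 3 8 (Branch 6 8 (Reduce 44) (Path 3 5 8 6)) (Few 0 3)) (Few 0 3))
    (Few 0 3))) (Branch 3 5 (Reduce 63) (Branch 3 6 (Branch 3 7 (Branch 3 8 (Reduce 64) (Few 0 3))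
    (Few 0 3)) (Few 0 3))))) (Branch 3 5 (Branch 4 6 (Reduce 65) (Branch 4 7 (Reduce 66)
    (Branch 4 8 (Reduce 67) (Branch 3 6 (Branch 4 5 (Reduce 62) (Branch 3 4 (Path 3 5 4 6)
    (Isolated 0 4))) (Branch 3 7 (Branch 4 5 (Reduce 68) (Branch 3 4 (Path 3 5 4 7)
    (Isolated 0 4))) (Branch 3 4 (Branch 3 8 (Path 3 4 8 5) (Few 0 3)) (Few 0 3))))))) (Branch 4 5
    (Branch 3 6 (Reduce 69) (Branch 3 4 (Branch 3 7 (Branch 3 8 (Reduce 70) (Few 0 3)) (Few 0 3))
    (Few 0 3))) (Isolated 0 5)))) (Few 0 2)) (Few 0 2)) (Few 0 2))))) (Few 0 1)) (Few 0 1))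
    (Few 0 1)).

(** Here 0 has degree 8 and small neighbours 1, 2, 3, which miss 4, 5, 6 respectively. Vertex 1 is
    closed with neighbours 0, 5, 6, 7, 8, so edges at 1 can be deleted along with those at 0. *)
Definition distinct_reds : seq reduction := [::
  Reduction [:: 0; 1] [:: [:: 0; 3; 5]; [:: 0; 2; 6]; [:: 0; 1; 8]; [:: 1; 6; 7]; [:: 0; 4; 7]]
    [:: (0, 4); (0, 6); (0, 7); (0, 8); (1, 5); (1, 8); (2, 6); (3, 5); (4, 7); (6, 7)];
  Reduction [:: 0; 1] [:: [:: 1; 7; 8]; [:: 1; 5; 6]; [:: 0; 6; 8]; [:: 0; 5; 7]; [:: 0; 3; 4]]
    [:: (0, 1); (0, 2); (0, 3); (0, 4); (3, 4); (5, 6); (5, 7); (5, 8); (6, 8); (7, 8)];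
  Reduction [:: 0; 1] [:: [:: 0; 3; 5]; [:: 0; 2; 6]; [:: 0; 1; 7]; [:: 1; 6; 8]; [:: 0; 4; 8]]
    [:: (0, 4); (0, 6); (0, 7); (0, 8); (1, 5); (1, 7); (2, 6); (3, 5); (4, 8); (6, 8)];
  Reduction [:: 0; 1] [:: [:: 1; 7; 8]; [:: 1; 5; 6]; [:: 0; 6; 7]; [:: 0; 5; 8]; [:: 0; 3; 4]]
    [:: (0, 1); (0, 2); (0, 3); (0, 4); (3, 4); (5, 6); (5, 7); (5, 8); (6, 7); (7, 8)];
  Reduction [:: 0; 1] [:: [:: 0; 3; 5]; [:: 0; 2; 4]; [:: 0; 1; 8]; [:: 1; 5; 7]; [:: 0; 6; 7]]
    [:: (0, 4); (0, 6); (0, 7); (0, 8); (1, 5); (1, 8); (2, 4); (3, 5); (5, 7); (6, 7)];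
  Reduction [:: 0; 1] [:: [:: 1; 7; 8]; [:: 1; 5; 6]; [:: 0; 6; 7]; [:: 0; 5; 8]; [:: 0; 3; 4]]
    [:: (0, 1); (0, 2); (0, 3); (0, 4); (3, 4); (5, 6); (5, 8); (6, 7); (6, 8); (7, 8)]].

Definition distinct_tree : dtree := Branch 4 7 (Branch 6 7 (Reduce 0) (Branch 5 6 (Branch 5 7
    (Branch 6 8 (Branch 7 8 (Reduce 1) (Path 1 6 7 8)) (Path 1 7 6 8)) (Path 1 5 7 6))
    (Path 1 5 6 7))) (Branch 4 8 (Branch 6 8 (Reduce 2) (Branch 5 6 (Branch 5 8 (Branch 6 7
    (Branch 7 8 (Reduce 3) (Path 1 6 8 7)) (Path 1 7 6 8)) (Path 1 5 8 6)) (Path 1 5 6 8)))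
    (Branch 6 7 (Branch 5 7 (Reduce 4) (Branch 5 6 (Branch 5 8 (Branch 7 8 (Reduce 5)
    (Path 1 5 7 8)) (Path 1 7 5 8)) (Path 1 6 5 7))) (Branch 5 6 (Branch 5 7 (Branch 6 8
    (Branch 7 8 (Reduce 1) (Path 1 6 7 8)) (Path 1 7 6 8)) (Path 1 5 7 6)) (Path 1 5 6 7)))).

(** * Validity of the certificates *)

Lemma deg1_ok : check_one 1 [::] [::] deg1_reds [::] [::] deg1_tree.
Proof. by vm_compute. Qed.

Lemma deg2_ok : check_one 2 [::] [::] deg2_reds [::] [::] deg2_tree.
Proof. by vm_compute. Qed.

Lemma deg3_ok : check_one 3 [::] [::] deg3_reds [::] [::] deg3_tree.
Proof. by vm_compute. Qed.

Lemma deg4_ok : check_one 4 [::] [::] deg4_reds [::] [::] deg4_tree.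
Proof. by vm_compute. Qed.

Lemma path5_ok : check_one 5 [::] [::] path5_reds [::] [:: (1, 2); (2, 3)] path5_tree.
Proof. by vm_compute. Qed.

Lemma path6_ok : check_one 6 [::] [::] path6_reds [::] [:: (1, 2); (2, 3)] path6_tree.
Proof. by vm_compute. Qed.

Lemma adj_5_5_4_ok : check_two 4 0 0 [:: 0; 1] adj_5_5_4_reds [::] [::] adj_5_5_4_tree.
Proof. by vm_compute. Qed.

Lemma adj_5_5_3_ok : check_two 3 1 1 [:: 0; 1] adj_5_5_3_reds [::] [::] adj_5_5_3_tree.
Proof. by vm_compute. Qed.

Lemma adj_5_6_4_ok : check_two 4 0 1 [:: 0; 1] adj_5_6_4_reds [::] [::] adj_5_6_4_tree.
Proof. by vm_compute. Qed.

Lemma adj_6_6_5_ok : check_two 5 0 0 [:: 0; 1] adj_6_6_5_reds [::] [::] adj_6_6_5_tree.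
Proof. by vm_compute. Qed.

Lemma adj_6_6_4_ok : check_two 4 1 1 [:: 0; 1] adj_6_6_4_reds [::] [::] adj_6_6_4_tree.
Proof. by vm_compute. Qed.

Lemma adj_5_7_4_ok : check_two 4 0 2 [:: 0] adj_5_7_4_reds [::] [::] adj_5_7_4_tree.
Proof. by vm_compute. Qed.

Lemma adj_6_7_5_ok : check_two 5 0 1 [:: 0] adj_6_7_5_reds [::] [::] adj_6_7_5_tree.
Proof. by vm_compute. Qed.

Lemma adj_6_7_4_ok : check_two 4 1 2 [:: 0] adj_6_7_4_reds [::] [::] adj_6_7_4_tree.
Proof. by vm_compute. Qed.

Lemma exc_common_ok : check_two 3 1 3 [:: 0] exc_common_reds [::] [:: (2, 3)] exc_common_tree.
Proof. by vm_compute. Qed.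

Lemma exc_private_ok : check_two 3 1 3 [:: 0] exc_private_reds [::] [:: (2, 6)] exc_private_tree.
Proof. by vm_compute. Qed.

Lemma exc_pendant_ok : check_two 3 1 3 [:: 0] exc_pendant_reds [::]
  [:: (6, 7); (6, 8)] exc_pendant_tree.
Proof. by vm_compute. Qed.

Definition pairs_of l : seq (nat * nat) := [seq p <- allpairs pair l l | p.1 < p.2].
Lemma nine_ok : check_one 9 [::] (iota 1 6) nine_reds [::] (pairs_of (iota 1 6)) nine_tree.
Proof. by vm_compute. Qed.

Lemma eight_ok : check_one 8 [::] (iota 1 4) eight_reds [::] (pairs_of (iota 1 4)) eight_tree.
Proof. by vm_compute. Qed.

Lemma shared_ok : check_one 8 [::] (iota 1 3) shared_reds [::]
  ([:: (1, 4); (2, 4)] ++ pairs_of (iota 1 3)) shared_tree.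
Proof. by vm_compute. Qed.

Lemma distinct_ok : check_one 8 [:: 1] (iota 1 3) distinct_reds
  (star 1 (iota 5 4) ++ [:: (2, 4); (3, 4); (3, 5); (2, 6)])
  ([:: (1, 4); (2, 5); (3, 6)] ++ pairs_of (iota 1 3)) distinct_tree.
Proof. by vm_compute. Qed.

(** * Local structure of irreducible graphs *)

Section Irreducible.
Variables (T : finType) (e : rel T).
Hypotheses (simple_e : simple_graph e) (irr : irreducible e).

Let symE x y : e x y = e y x. Proof. by case: simple_e. Qed.
Let irrE x : e x x = false. Proof. by case: simple_e => _; apply. Qed.

Definition nbh v := [set u | e v u].
Definition deg v := #|nbh v|.

Lemma in_nbh v u : (u \in nbh v) = e v u. Proof. by rewrite inE. Qed.

(* The path condition says that the complement of the neighbourhood is a matching. *)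
Definition low v := 4 < deg v /\
  forall a b c, e v a -> e v b -> e v c -> uniq [:: a; b; c] -> e a b || e b c.

Lemma adj_neq x y : e x y -> x != y.
Proof. by apply: contraTneq => ->; rewrite irrE. Qed.

(** The neighbours of v missed by w are joined to w in the complement of the neighbourhood of v,
    which is a matching, so there is at most one. The second unit is w itself. *)
Lemma low_common v w : low v -> e v w -> deg v <= #|nbh v :&: nbh w| + 2.
Proof.
move=> [dv path] evw.
have : #|(nbh v :\ w) :\: nbh w| <= 1.
  rewrite leqNgt; apply/negP => /card_gt1P[a [c [ha hc ac]]].
  move: ha hc; rewrite !inE => /and3P[wa aw va] /and3P[wc cw vc].
  have := path a w c va evw vc; rewrite (negPf wc) symE (negPf wa) => h.
  by apply: notF; apply: h; rewrite /= !inE negb_or aw ac eq_sym cw.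
have := cardsD1 w (nbh v); rewrite in_nbh evw.
have := cardsID (nbh w) (nbh v :\ w).
have -> : (nbh v :\ w) :&: nbh w = nbh v :&: nbh w.
  apply/setP => x; rewrite !inE; case: eqVneq => [->|_]; rewrite ?irrE ?andbF //=.
rewrite -/(deg v); lia.
Qed.

(** * Soundness of the checker *)

Section Configuration.
Variables (s : seq T) (x0 : T).
Hypothesis uniq_s : uniq s.
Local Notation x_ := (nth x0 s).
Local Notation n := (size s).

Definition facts E A :=
  all (fun p => e (x_ p.1) (x_ p.2)) E && all (fun p => ~~ e (x_ p.1) (x_ p.2)) A.

Lemma facts_present E A i j : facts E A -> joins E i j -> e (x_ i) (x_ j).
Proof.
by move=> /andP[/allP h _] /orP[/h//|/h]; rewrite symE.
Qed.

Lemma facts_absent E A i j : facts E A -> joins A i j -> e (x_ i) (x_ j) = false.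
Proof.
by move=> /andP[_ /allP h] /orP[/h/negPf//|/h/negPf]; rewrite symE.
Qed.

Variables (closed lows : seq nat) (reds : seq reduction).
Hypothesis closedP : forall i, i \in closed -> forall y, e (x_ i) y -> y \in s.
Hypothesis lowP : forall i, i \in lows -> low (x_ i).

Definition tri (t : seq nat) : {set T} := [set x in map x_ t].

Lemma mem_index y : y \in s -> exists2 i, i < n & y = x_ i.
Proof. by move=> ys; exists (index y s); rewrite ?index_mem ?nth_index. Qed.

Lemma tri_index t x : x \in tri t -> exists2 i, i \in t & x = x_ i.
Proof. by rewrite inE => /mapP. Qed.

Lemma x_inj i j : i < n -> j < n -> x_ i = x_ j -> i = j.
Proof. by move=> li lj /eqP; rewrite nth_uniq // => /eqP. Qed.

Lemma all_pairsP (r : rel nat) l i j :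
  all_pairs r l -> i \in l -> j \in l -> i != j -> r i j.
Proof.
move=> /allP h /h/allP{}h /h; by case: eqVneq.
Qed.

(** The intersection with [edges e] allows C to contain pairs whose adjacency is undecided; it can
    only make the cover smaller. *)
Definition cover_edges (C : seq (nat * nat)) : {set {set T}} :=
  [set A in map (fun p => [set x_ p.1; x_ p.2]) C] :&: edges e.

Lemma in_cover C i j : e (x_ i) (x_ j) -> joins C i j -> [set x_ i; x_ j] \in cover_edges C.
Proof.
move=> eij jij; rewrite !inE; apply/andP; split; last first.
  by apply/existsP; exists (x_ i); apply/existsP; exists (x_ j); rewrite eij eqxx.
apply/mapP; case/orP: jij => h; [by exists (i, j)|exists (j, i) => //].
by rewrite setUC.
Qed.

(** Presents a triangle as v and two adjacent neighbours of v, the form in which the last clause of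
    [valid_reduction] speaks about it. *)
Lemma tri_pairs (t : {set T}) v A :
  is_triangle e t -> A \in tri_edges t -> v \in A ->
  exists a b, [/\ e v a, e v b, e a b & t = [set v; a; b]].
Proof.
move=> tt /tri_edgesP[x [y [xy xt yt ->]]] vA.
have [a [va at_]] : exists a, v != a /\ a \in t.
  by move: vA; rewrite !inE => /orP[]/eqP->; [exists y|exists x; rewrite eq_sym].
have vt : v \in t by move: vA; rewrite !inE => /orP[]/eqP->.
case/andP: (tt) => /eqP c3 _.
have : 0 < #|t :\ v :\ a|.
  have := cardsD1 v t; rewrite vt c3; have := cardsD1 a (t :\ v).
  by rewrite !inE at_ eq_sym va /=; lia.
case/card_gt0P => b; rewrite !inE => /and3P[ba bv bt].
exists a, b; split; try by apply: (triangle_edge tt) => //; rewrite eq_sym.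
apply/esym/eqP; rewrite eqEcard !subUset !sub1set vt at_ bt c3 /=.
by rewrite -setUA cardsU1 !inE negb_or va eq_sym bv cards2 eq_sym ba.
Qed.

Lemma edge_set2 x y : e x y -> [set x; y] \in edges e.
Proof. by move=> exy; apply/edgesP; exists x, y. Qed.

Lemma valid_reduction_sound E A r :
  facts E A -> valid_reduction n closed E A r -> False.
Proof.
case: r => V P C fct /and5P[/allP Vc /hasP[v0 v0V /hasP[j0 _ j0E]] /allP Pok /andP[uP /allP Pdis]].
case/andP=> leCP /allP cov.
pose X := cover_edges C :|: [set B in edges e | ~~ [disjoint B & tri V]].
have xV i : i \in V -> x_ i \in tri V by move=> iV; rewrite inE; apply/mapP; exists i.
have inX B v : B \in edges e -> v \in V -> x_ v \in B -> B \in X.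
  move=> Be vV vB; apply/setUP; right; rewrite inE Be; apply/pred0Pn.
  by exists (x_ v); rewrite /= vB xV.
have tE t i j : t \in P -> i \in t -> j \in t -> i != j -> 
    joins E i j && [|| i \in V, j \in V | joins C i j].
  by move=> /Pok/and4P[_ _ _ h]; exact: (all_pairsP h).
have tlt t i : t \in P -> i \in t -> i < n.
  by move=> /Pok/and4P[_ _ /allP h _] /h.
have tritri t : t \in P -> is_triangle e (tri t).
  move=> tP; have /and4P[/eqP st ut _ _] := Pok t tP.
  rewrite /is_triangle; apply/andP; split.
    rewrite cardsE; have/card_uniqP -> : uniq (map x_ t).
      by rewrite map_inj_in_uniq // => i j it jt; apply: x_inj; apply: tlt tP _.
    by rewrite size_map st.
  apply/forall_inP => x /tri_index[i it ->]; apply/forall_inP => y /tri_index[j jt ->].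
  apply/implyP => ne; have {ne} ij : i != j by apply: contraNneq ne => ->.
  by have /andP[/(facts_present fct)] := tE t i j tP it jt ij.
have triX t : t \in P -> tri_edges (tri t) \subset X.
  move=> tP; apply/subsetP => B /tri_edgesP[x [y [xy xt yt ->]]].
  have exy := triangle_edge (tritri t tP) xt yt xy.
  move: exy xy; have [i it ->] := tri_index xt; have [j jt ->] := tri_index yt => exy xy.
  have ij : i != j by apply: contraNneq xy => ->.
  have /andP[_ /or3P[iV|jV|ijC]] := tE t i j tP it jt ij.
  - by apply: inX iV _; rewrite ?edge_set2 ?set21.
  - by apply: inX jV _; rewrite ?edge_set2 ?set22.
  by rewrite in_setU in_cover.
have tdis t u : t \in P -> u \in P -> t != u -> [disjoint tri_edges (tri t) & tri_edges (tri u)].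
  move=> tP uP' tu; have /allP/(_ u uP') := Pdis t tP; rewrite (negPf tu) /= => tup.
  rewrite disjoint_subset; apply/subsetP => B.
  case/tri_edgesP=> x [y [xy /tri_index[i it ex] /tri_index[j jt ey] ->]].
  rewrite !inE subUset !sub1set; apply/negP.
  case/andP=> /andP[/tri_index[i' i'u exi] /tri_index[j' j'u eyj]] _.
  have ij : i != j by apply: contraNneq xy => ij; rewrite ex ey ij.
  have := all_pairsP tup it jt ij.
  rewrite (x_inj (tlt _ _ tP it) (tlt _ _ uP' i'u) _) -?ex // i'u.
  by rewrite (x_inj (tlt _ _ tP jt) (tlt _ _ uP' j'u) _) -?ey // j'u.
(* Different members of P give different vertex sets, since equal sets would share their edges; so
   no triangle is lost in the count. *)
have sP : #|[set t in map tri P]| = size P.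
  rewrite cardsE; have /card_uniqP -> : uniq (map tri P); last by rewrite size_map.
  rewrite map_inj_in_uniq // => t u tP uP' etu; apply/eqP; apply: contraT => tu.
  have := tdis t u tP uP' tu; rewrite etu -setI_eq0 setIid => /eqP h.
  by have := tri_edges_neq0 (tritri u uP'); rewrite h eqxx.
have [||||||t [tt meet miss]] := irr (X := X) (P := [set t in map tri P]) (S := cover_edges C).
- have e00 := facts_present fct j0E; apply/set0Pn; exists [set x_ v0; x_ j0].
  by apply: inX v0V _; rewrite ?edge_set2 ?set21.
- by rewrite subUset subsetIr; apply/subsetP => B /setIdP[].
- exact: subsetUl.
- split=> [t|t u]; rewrite !in_set; first by case/mapP=> t' t'P ->; exact: tritri.
  case/mapP=> t' t'P -> /mapP[u' u'P ->] ne; apply: tdis => //.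
  by apply: contraNneq ne => ->.
- by move=> t; rewrite in_set => /mapP[t' t'P ->]; exact: triX.
- rewrite sP; apply: leq_trans leCP; apply: leq_trans (subset_leq_card (subsetIl _ _)) _.
  by rewrite cardsE (leq_trans (card_size _)) // size_map.
(* A triangle missing the cover meets X in an edge at some v in V. As v is closed, its other two
   vertices a and b are numbered, and the last clause, applied to them, contradicts the edge ab
   being present and uncovered. *)
have [B /andP[/= Bt]] := pred0Pn meet.
case/setUP => [BC|]; first by rewrite (disjointFr miss Bt) in BC.
case/setIdP=> _ /pred0Pn[y /andP[/= yB /tri_index[v vV ey]]].
have [y1 [y2 [e1 e2 e12 et]]] := tri_pairs tt Bt yB; rewrite ey in e1 e2 et.
have := closedP (Vc v vV) e1; case/mem_index => a la ea.
have := closedP (Vc v vV) e2; case/mem_index => b lb eb.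
rewrite {}ea {}eb in e1 e2 e12 et.
have notC i j : x_ i \in t -> x_ j \in t -> e (x_ i) (x_ j) -> joins C i j = false.
  move=> it jt eij; apply: contraTF miss => h; apply/pred0Pn; exists [set x_ i; x_ j].
  by rewrite /= (in_cover eij h) tri_edges_set2 // adj_neq.
have notA i j : e (x_ i) (x_ j) -> joins A i j = false.
  by move=> eij; apply: contraTF eij => /(facts_absent fct) ->.
have [vt at_ bt] : [/\ x_ v \in t, x_ a \in t & x_ b \in t].
  by rewrite et !inE !eqxx !orbT.
have inl i : i < n -> x_ i \in t -> e (x_ v) (x_ i) ->
    i \in [seq i <- iota 0 n | [&& i != v, ~~ joins A v i & ~~ joins C v i]].
  move=> li it evi; rewrite mem_filter mem_iota li notA // notC // !andbT /=.
  by apply: contraTneq evi => ->; rewrite irrE.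
have := all_pairsP (cov v vV) (inl a la at_ e1) (inl b lb bt e2).
rewrite notA // notC // => h; suff: a != b by move/h.
by apply: contraTneq e12 => ->; rewrite irrE.
Qed.

(** At a branch the actual graph satisfies the facts of one of the two subtrees, so following it
    leads to a leaf, where the facts contradict irreducibility or lowness. *)
Lemma check_sound E A d :
  facts E A -> ~~ check n closed lows reds E A d.
Proof.
move=> fct; apply/negP; elim: d E A fct => [i j d1 IH1 d2 IH2|k|v a|v a b c|w v] E A fct /=.
- case/andP=> c1 c2; case/andP: (fct) => fE fA.
  have [eij|nij] := boolP (e (x_ i) (x_ j)).
    by apply: (IH1 _ _ _ c1); rewrite /facts /= eij fE.
  by apply: (IH2 _ _ _ c2); rewrite /facts /= nij fE.
- exact: valid_reduction_sound.
- case/and3P=> vc /(facts_present fct) eva /allP h.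
  pose B := [set x_ v; x_ a].
  (* With empty packing and empty cover, irreducibility says that the edge B lies in a triangle. *)
  have [||||||t [tt meet _]] := irr (X := [set B]) (P := set0) (S := set0).
  + by apply/set0Pn; exists B; rewrite inE.
  + by rewrite sub1set edge_set2.
  + exact: sub0set.
  + by split=> [t|t u]; rewrite inE.
  + by move=> t; rewrite inE.
  + by rewrite !cards0.
  have [B' /andP[/= Bt]] := pred0Pn meet; rewrite inE => /eqP eB; rewrite {}eB in Bt.
  have [y1 [y2 [e1 e2 e12 et]]] := tri_pairs tt Bt (set21 _ _).
  have at_ : x_ a \in t.
    by move: Bt; rewrite in_tri_edges subUset !sub1set => /andP[/andP[]].
  have [y [ey eay]] : exists y, e (x_ v) y /\ e (x_ a) y.
    move: at_; rewrite et !inE -orbA => /or3P[]/eqP ea.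
    - by rewrite ea irrE in eva.
    - by exists y2; rewrite ea.
    by exists y1; rewrite ea e1 symE.
  have [i li yi] := mem_index (closedP vc ey); rewrite {}yi in ey eay.
  have := h i; rewrite mem_iota li => /(_ isT).
  have notA j k : e (x_ j) (x_ k) -> joins A j k = false.
    by move=> ejk; apply: contraTF ejk => /(facts_absent fct) ->.
  rewrite !notA //= => /orP[]/eqP ei; by rewrite ei irrE in ey eay.
- case/and4P=> /lowP[_ path].
  case/and3P=> /(facts_present fct) va /(facts_present fct) vb /(facts_present fct) vc.
  case/andP=> /(facts_absent fct) ab /(facts_absent fct) bc /andP[u3 l3].
  have := path _ _ _ va vb vc; rewrite ab bc => h; apply: notF; apply: h.
  rewrite (_ : [:: _; _; _] = map x_ [:: a; b; c]) // map_inj_in_uniq // => i j.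
  have l3' : all (gtn n) [:: a; b; c] := l3.
  by move=> /(allP l3') li /(allP l3') lj; apply: x_inj.
(* A low vertex has degree at least 5, hence at least 5 - 2 = 3 common neighbours with w. These are
   numbered because w is closed, and A rules out none of them, so the filter keeps at least three
   numbers. *)
case/and4P=> wc /lowP lv /(facts_present fct) wv; apply/negP; rewrite -leqNgt.
rewrite symE in wv; have := low_common lv wv; have [dv _] := lv.
move=> /(leq_trans dv); rewrite addn2 !ltnS => /leq_trans; apply; rewrite symE in wv.
rewrite -size_filter -(size_map x_); apply: leq_trans (card_size _).
apply: subset_leq_card; apply/subsetP => y; rewrite !inE => /andP[vy wy].
have [i li ei] := mem_index (closedP wc wy); apply/mapP; exists i => //.
rewrite ei in vy wy; rewrite mem_filter mem_iota li andbT /=.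
have notA j k : e (x_ j) (x_ k) -> joins A j k = false.
  by move=> ejk; apply: contraTF ejk => /(facts_absent fct) ->.
rewrite !notA // !andbT; apply/andP; split.
  by apply: contraTneq vy => ->; rewrite irrE.
by apply: contraTneq wy => ->; rewrite irrE.
Qed.

End Configuration.

(** * Configurations around one or two vertices *)

Lemma all_nth_iota (x0 : T) (P : pred T) s1 s2 s3 :
  all (fun i => P (nth x0 (s1 ++ s2 ++ s3) i)) (iota (size s1) (size s2)) = all P s2.
Proof.
elim: s2 s1 => //= x s2 IH s1; rewrite nth_cat ltnn subnn /=; congr andb.
by rewrite -cat_rcons -(size_rcons s1 x) IH.
Qed.

Lemma facts_cat s x0 E1 A1 E2 A2 :
  facts s x0 (E1 ++ E2) (A1 ++ A2) = facts s x0 E1 A1 && facts s x0 E2 A2.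
Proof. by rewrite /facts !all_cat andbACA. Qed.

Lemma one_center v vs closed lows reds E A d :
  uniq vs -> (forall x, (x \in vs) = e v x) ->
  (forall i, i \in closed -> forall y, e (nth v (v :: vs) i) y -> y \in v :: vs) ->
  (forall i, i \in lows -> low (nth v (v :: vs) i)) ->
  facts (v :: vs) v E A ->
  check_one (size vs) closed lows reds E A d -> False.
Proof.
move=> uvs vsE cl lo fct; apply/negP.
apply: (@check_sound (v :: vs) v) => //.
- by rewrite /= vsE irrE.
- by move=> i; rewrite inE => /orP[/eqP-> y evy|/cl//]; rewrite inE vsE evy orbT.
rewrite -[A]cat0s facts_cat fct andbT /facts andbT all_map /preim /=.
have := all_nth_iota v (e v) [:: v] vs [::]; rewrite cats0 /= => ->.
by apply/allP => x; rewrite vsE.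
Qed.

(** Common and private neighbours exhaust both neighbourhoods, so the two centres are closed;
    privacy supplies the absent pairs of [two_absent]. *)
Lemma two_centers u v cs us vs lows reds E A d :
  e u v -> uniq cs -> uniq us -> uniq vs ->
  (forall x, (x \in cs) = e u x && e v x) ->
  (forall x, (x \in us) = [&& x != v, e u x & ~~ e v x]) ->
  (forall x, (x \in vs) = [&& x != u, e v x & ~~ e u x]) ->
  let s := u :: v :: cs ++ us ++ vs in
  (forall i, i \in lows -> low (nth u s i)) -> facts s u E A ->
  check_two (size cs) (size us) (size vs) lows reds E A d -> False.
Proof.
move=> euv ucs uus uvs csE usE vsE s lo fct; apply/negP.
have us_s : uniq s.
  rewrite /s /= inE !mem_cat !cat_uniq ucs uus uvs !negb_or (adj_neq euv) /=.
  rewrite !csE !usE !vsE !irrE !eqxx !andbF /=.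
  apply/and3P; split=> //; apply/hasPn => x; rewrite ?mem_cat ?csE ?usE ?vsE.
    by case/orP=> /and3P[_ -> /negPf->]; rewrite ?andbF.
  by case/and3P=> _ -> ; rewrite andbF andbF.
rewrite /check_two; have -> : 2 + size cs + size us + size vs = size s by rewrite /= !size_cat; lia.
apply: (@check_sound s u us_s) => //.
- move=> i; rewrite !inE => /orP[]/eqP-> y ey; rewrite /s !inE !mem_cat csE usE vsE ey;
  rewrite ?(symE v u) ?(symE u v).
    by case: (eqVneq y v) => //=; case: (e v y); rewrite ?orbT.
  by case: (eqVneq y u) => //=; case: (e u y); rewrite ?orbT.
have nthP s1 s2 s3 (P : pred T) m k : s = s1 ++ s2 ++ s3 -> m = size s1 -> k = size s2 ->
    {in s2, forall x, P x} -> all (fun i => P (nth u s i)) (iota m k).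
  by move=> -> -> -> h; rewrite all_nth_iota; apply/allP.
rewrite facts_cat fct andbT /facts /two_present /two_absent /= all_cat !all_map euv all_cat.
apply/andP; split; [apply/and4P; split=> //|rewrite all_cat !all_map; apply/andP; split].
- apply: (nthP [:: u; v] (cs ++ us) vs (e u)); rewrite ?catA ?size_cat //.
    by rewrite /s /= catA.
  by move=> x; rewrite mem_cat csE usE; case: (e u x); rewrite ?andbF.
- apply: (nthP [:: u; v] cs (us ++ vs) (e v)) => // x.
  by rewrite csE => /andP[].
- apply: (nthP (u :: v :: cs ++ us) vs [::] (e v)); rewrite ?cats0 /= ?size_cat //.
    by rewrite /s /= catA.
  by move=> x; rewrite vsE => /and3P[].
- apply: (nthP (u :: v :: cs ++ us) vs [::] (fun x => ~~ e u x)); rewrite ?cats0 /= ?size_cat //.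
    by rewrite /s /= catA.
  by move=> x; rewrite vsE => /and3P[].
apply: (nthP (u :: v :: cs) us vs (fun x => ~~ e v x)) => //.
by move=> x; rewrite usE => /and3P[].
Qed.

Lemma size_nbh v vs : uniq vs -> (forall x, (x \in vs) = e v x) -> size vs = deg v.
Proof.
by move=> /card_uniqP <- h; apply: eq_card => x; rewrite h inE.
Qed.

(** Certificates give fixed numbers to the vertices named in their assumptions. Those vertices are
    listed first, and the rest of their class follows in any order. *)
Lemma enum_extend (P : pred T) l : uniq l -> all P l ->
  exists r, uniq (l ++ r) /\ (forall x, (x \in l ++ r) = P x).
Proof.
move=> ul /allP lP; exists [seq x <- enum P | x \notin l]; split.
  rewrite cat_uniq ul filter_uniq ?enum_uniq // andbT.
  by apply/hasPn => x; rewrite mem_filter => /andP[].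
move=> x; rewrite mem_cat mem_filter mem_enum.
by case: (boolP (x \in l)) => //= /lP ->.
Qed.

(** * Vertices of degree at most 6 and their neighbours *)

Lemma one_center_deg v reds d :
  check_one (deg v) [::] [::] reds [::] [::] d -> False.
Proof.
have [r [ur rE]] := @enum_extend (e v) [::] isT isT.
by rewrite -(size_nbh ur rE); apply: one_center.
Qed.

(** Degree 4 shows the pattern. Two disjoint edges among the neighbours pack two triangles, and
    these edges with the two spokes to the ends of one of them hit all triangles at v. Otherwise
    some neighbour is isolated among the neighbours, so its spoke lies in no triangle, or they form
    a star; then one triangle is packed, and the spoke to the centre hits all triangles at v. *)
Lemma low_of_deg v : 0 < deg v <= 6 -> low v.
Proof.
move=> /andP[d0 d6]; have d4 : 4 < deg v.
  rewrite ltnNge; apply/negP => d4.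
  have [d1|[d2|[d3|d4']]] : deg v = 1 \/ deg v = 2 \/ deg v = 3 \/ deg v = 4 by lia.
  - by apply: (@one_center_deg v); rewrite d1; exact: deg1_ok.
  - by apply: (@one_center_deg v); rewrite d2; exact: deg2_ok.
  - by apply: (@one_center_deg v); rewrite d3; exact: deg3_ok.
  - by apply: (@one_center_deg v); rewrite d4'; exact: deg4_ok.
split=> // a b c va vb vc abc; apply/negPn/negP; rewrite negb_or => /andP[ab bc].
(* Listing a, b, c first gives them the numbers 1, 2, 3 of the path certificates. *)
have [|r [ur rE]] := @enum_extend (e v) _ abc; first by rewrite /= va vb vc.
have sr := size_nbh ur rE.
have fct : facts (v :: [:: a; b; c] ++ r) v [::] [:: (1, 2); (2, 3)].
  by rewrite /facts /= ab bc.
have [d5|d6'] : deg v = 5 \/ deg v = 6 by lia.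
  by move: path5_ok; rewrite -d5 -sr; apply: (one_center ur rE _ _ fct).
by move: path6_ok; rewrite -d6' -sr; apply: (one_center ur rE _ _ fct).
Qed.

Lemma card_private u v :
  e u v -> #|nbh u :\: nbh v :\ v| = deg u - #|nbh u :&: nbh v|.+1.
Proof.
move=> euv; have := cardsID (nbh v) (nbh u); have := cardsD1 v (nbh u :\: nbh v).
by rewrite !inE irrE euv /= /deg; lia.
Qed.

(** The two degrees and the number of common neighbours determine the numbered configuration, so one
    certificate per triple of numbers suffices. *)
Lemma two_centers_deg u v lows reds d :
  e u v -> all (gtn 2) lows ->
  (forall i, i \in lows -> low (nth u [:: u; v] i)) ->
  let c := #|nbh u :&: nbh v| in
  check_two c (deg u - c.+1) (deg v - c.+1) lows reds [::] [::] d -> False.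
Proof.
move=> euv /allP l2 lo c.
pose D a b := enum (nbh a :\: nbh b :\ b).
have sD a b : e a b -> size (D a b) = deg a - #|nbh a :&: nbh b|.+1.
  by move=> eab; rewrite -cardE card_private.
have DE a b x : (x \in D a b) = [&& x != b, e a x & ~~ e b x].
  by rewrite mem_enum !inE; case: (e a x); rewrite ?andbF ?andbT.
have cE x : (x \in enum (nbh u :&: nbh v)) = e u x && e v x by rewrite mem_enum !inE.
have evu : e v u by rewrite symE.
have := two_centers euv (enum_uniq _) (enum_uniq _) (enum_uniq _) cE (DE u v) (DE v u).
move=> /(_ lows reds [::] [::] d); rewrite !sD // setIC -cardE setIC; apply=> // i il.
by have := l2 i il; have := lo i il; case: i {il} => [|[|]].
Qed.

Lemma deg_gt0 u v : e u v -> 0 < deg u.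
Proof. by move=> euv; apply/card_gt0P; exists v; rewrite inE. Qed.

Lemma common_lt u v : e u v -> #|nbh u :&: nbh v| < deg u.
Proof.
move=> euv; apply: proper_card; rewrite properE subsetIl.
by apply/subsetPn; exists v; rewrite !inE ?irrE ?andbF.
Qed.

(** With deg u at most deg v, lowness of both ends gives deg v - 2 <= c < deg u for the number c of
    common neighbours. This leaves five triples, each with its own certificate. *)
Lemma small_nonadjacent u v : e u v -> deg u <= 6 -> 6 < deg v.
Proof.
move=> euv du; rewrite ltnNge; apply/negP => dv.
wlog le_uv : u v euv du dv / deg u <= deg v.
  by move=> h; have [/h|/ltnW/h] := leqP (deg u) (deg v); apply=> //; rewrite symE.
have evu : e v u by rewrite symE.
have lu : low u by apply: low_of_deg; rewrite (deg_gt0 euv).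
have lv : low v by apply: low_of_deg; rewrite (deg_gt0 evu).
have lows i : i \in [:: 0; 1] -> low (nth u [:: u; v] i).
  by rewrite !inE => /orP[]/eqP->.
have c1 := low_common lu euv; have c2 := low_common lv evu.
have h reds d := @two_centers_deg u v [:: 0; 1] reds d euv isT lows.
rewrite setIC in c2; move: h c1 c2 (common_lt euv); case: lu lv => [du4 _] [dv4 _].
move: #|_| => c /= h c1 c2 c3.
have [E|[E|[E|[E|E]]]] :
    c = 4 /\ deg u = 5 /\ deg v = 5 \/ c = 3 /\ deg u = 5 /\ deg v = 5 \/
    c = 4 /\ deg u = 5 /\ deg v = 6 \/ c = 5 /\ deg u = 6 /\ deg v = 6 \/
    c = 4 /\ deg u = 6 /\ deg v = 6 by lia.
all: case: E h => [-> [-> ->]] h.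
- exact: h _ _ adj_5_5_4_ok.
- exact: h _ _ adj_5_5_3_ok.
- exact: h _ _ adj_5_6_4_ok.
- exact: h _ _ adj_6_6_5_ok.
- exact: h _ _ adj_6_6_4_ok.
Qed.

(** Lowness of x gives deg x - 2 <= c < deg x. Three of the four remaining cases are reducible; the
    conclusion is the fourth. *)
Lemma seven_neighbour x w : e x w -> deg x <= 6 -> deg w = 7 ->
  deg x = 5 /\ #|nbh x :&: nbh w| = 3.
Proof.
move=> exw dx dw; have lx : low x by apply: low_of_deg; rewrite (deg_gt0 exw).
have c1 := low_common lx exw; have c2 := common_lt exw; case: (lx) => dx4 _.
have lows i : i \in [:: 0] -> low (nth x [:: x; w] i) by rewrite inE => /eqP->.
have h reds d := @two_centers_deg x w [:: 0] reds d exw isT lows.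
move: h c1 c2; rewrite dw; move: #|_| => c /= h c1 c2.
have [//|E] : deg x = 5 /\ c = 3 \/
    c = 4 /\ deg x = 5 \/ c = 5 /\ deg x = 6 \/ c = 4 /\ deg x = 6 by lia.
exfalso; case: E => [E|[E|E]]; case: E h => [-> ->] h.
- exact: h _ _ adj_5_7_4_ok.
- exact: h _ _ adj_6_7_5_ok.
- exact: h _ _ adj_6_7_4_ok.
Qed.

(* Here [x] has degree 5 and exactly one missing edge in its neighbourhood. The
   resulting configuration is not reducible, but [common_small_neighbours] makes
   up for the charge that [w] cannot give. *)
Section Exceptional.
Variables (x w : T).
Hypotheses (exw : e x w) (dx : deg x <= 6) (dw : deg w = 7).

Let lx : low x. Proof. by apply: low_of_deg; rewrite (deg_gt0 exw). Qed.

Let dx5 : deg x = 5. Proof. by case: (seven_neighbour exw dx dw). Qed.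
Let common3 : #|nbh x :&: nbh w| = 3. Proof. by case: (seven_neighbour exw dx dw). Qed.

Let common y := e x y && e w y.
Let only_x y := [&& y != w, e x y & ~~ e w y].
Let only_w y := [&& y != x, e w y & ~~ e x y].

Let sizes cs us vs : uniq cs -> uniq us -> uniq vs ->
  (forall y, (y \in cs) = common y) -> (forall y, (y \in us) = only_x y) ->
  (forall y, (y \in vs) = only_w y) -> [/\ size cs = 3, size us = 1 & size vs = 3].
Proof.
move=> ucs uus uvs csE usE vsE.
have card l (B : {set T}) : uniq l -> (forall y, (y \in l) = (y \in B)) -> size l = #|B|.
  by move=> /card_uniqP <- h; apply: eq_card.
have ewx : e w x by rewrite symE.
split.
- by rewrite -common3; apply: card => // y; rewrite csE !inE.
- rewrite (card us (nbh x :\: nbh w :\ w)) ?card_private ?common3 ?dx5 // => y.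
  by rewrite usE !inE /only_x [e x y && _]andbC.
- rewrite (card vs (nbh w :\: nbh x :\ x)) ?card_private // 1?setIC ?common3 ?dw // => y.
  by rewrite vsE !inE /only_w [e w y && _]andbC.
Qed.

Let contradiction cs us vs A reds d :
  uniq cs -> uniq us -> uniq vs ->
  (forall y, (y \in cs) = common y) -> (forall y, (y \in us) = only_x y) ->
  (forall y, (y \in vs) = only_w y) ->
  facts (x :: w :: cs ++ us ++ vs) x [::] A ->
  check_two 3 1 3 [:: 0] reds [::] A d -> False.
Proof.
move=> ucs uus uvs csE usE vsE fct.
have [s1 s2 s3] := sizes ucs uus uvs csE usE vsE.
rewrite -[X in check_two X]s1 -[X in check_two _ X]s2 -[X in check_two _ _ X]s3.
apply: (two_centers exw ucs uus uvs csE usE vsE _ fct) => i.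
by rewrite inE => /eqP->.
Qed.

Lemma common_clique a b : common a -> common b -> a != b -> e a b.
Proof.
move=> ca cb ab; apply/negPn/negP => nab.
have [||r [ur rE]] := @enum_extend common [:: a; b]; rewrite /= ?inE ?ab ?ca ?cb //.
have [us [uus usE]] := @enum_extend only_x [::] isT isT.
have [vs [uvs vsE]] := @enum_extend only_w [::] isT isT.
apply: (contradiction ur uus uvs rE usE vsE (A := [:: (2, 3)]) _ exc_common_ok).
by rewrite /facts /= nab.
Qed.

Lemma common_only_w a y : common a -> only_w y -> e a y.
Proof.
move=> ca wy; apply/negPn/negP => nay.
have [||r [ur rE]] := @enum_extend common [:: a]; rewrite /= ?ca //.
have [us [uus usE]] := @enum_extend only_x [::] isT isT.
have [||vs [uvs vsE]] := @enum_extend only_w [:: y]; rewrite /= ?wy //.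
(* The exact sizes fix the numbering: a becomes 2, and y comes after both centres, three common
   neighbours and the private neighbour of x, hence gets 6. *)
have [] := sizes ur uus uvs rE usE vsE.
case: r ur rE => [|b [|c [|? ?]]] // ur rE _.
case: us uus usE => [|f [|? ?]] // uus usE _ _.
apply: (contradiction ur uus uvs rE usE vsE (A := [:: (2, 6)]) _ exc_private_ok).
by rewrite /facts /= nay.
Qed.

Lemma only_w_adjacent y : only_w y -> exists2 z, only_w z & e y z.
Proof.
move=> wy; have [||vs [uvs vsE]] := @enum_extend only_w [:: y]; rewrite /= ?wy //.
have [cs [ucs csE]] := @enum_extend common [::] isT isT.
have [us [uus usE]] := @enum_extend only_x [::] isT isT.
have [] := sizes ucs uus uvs csE usE vsE; rewrite !cat0s in ucs uus csE usE.
case: cs ucs csE => [|a [|b [|c [|? ?]]]] // ucs csE _.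
case: us uus usE => [|f [|? ?]] // uus usE _.
case: vs uvs vsE => [|z [|t [|? ?]]] // uvs vsE _.
have [wz wt] : only_w z /\ only_w t by rewrite -!vsE !inE !eqxx !orbT.
have [yz|nyz] := boolP (e y z); first by exists z.
have [yt|nyt] := boolP (e y t); first by exists t.
exfalso; apply: (contradiction ucs uus uvs csE usE vsE (A := [:: (6, 7); (6, 8)]) _ exc_pendant_ok).
by rewrite /facts /= nyz nyt.
Qed.

(** In the complement of the neighbourhood of x, a matching, f is already matched with w, so it
    cannot miss a as well. *)
Lemma common_only_x a f : common a -> only_x f -> e a f.
Proof.
case/andP=> xa wa /and3P[fw xf nwf]; have [_ path] := lx.
have := path w f a exw xf xa; rewrite (negPf nwf) symE /= => -> //.
rewrite /= !inE negb_or eq_sym fw (adj_neq wa) !andbT /=.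
by apply: contraNneq nwf => ->.
Qed.

(** If y were small it would, like x, share exactly three neighbours with w. But it is adjacent to
    the three common neighbours of x and w and to a further neighbour z of w. *)
Lemma only_w_large y : only_w y -> 6 < deg y.
Proof.
move=> wy; rewrite ltnNge; apply/negP => dy.
have /and3P[yx ewy nxy] := wy; have eyw : e y w by rewrite symE.
have [_ c3] := seven_neighbour eyw dy dw.
have [z wz yz] := only_w_adjacent wy; have /and3P[_ ewz nxz] := wz.
suff : #|z |: (nbh x :&: nbh w)| <= #|nbh y :&: nbh w|.
  by rewrite cardsU1 c3 common3 !inE (negPf nxz).
apply/subset_leq_card/subsetP => a; rewrite !inE => /orP[/eqP->|ca].
  by rewrite yz.
by rewrite symE (common_only_w ca wy); case/andP: ca.
Qed.

Lemma common_dominates a : common a -> nbh x :\ a \subset nbh a.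
Proof.
move=> ca; apply/subsetP => y; rewrite !inE => /andP[ya xy].
have [wy|nwy] := boolP (e w y).
  by apply: common_clique; rewrite // 1?eq_sym // /common xy.
have [->|yw] := eqVneq y w; first by rewrite symE; case/andP: ca.
by apply: common_only_x; rewrite // /only_x yw xy.
Qed.

(** Apart from x and a, every vertex of the two neighbourhoods is a large neighbour of a: those at x
    are large because x is small, the others by [only_w_large]. Their number is 5 + 7 - 3 - 2 =
    7. *)
Lemma common_small_neighbours a : common a ->
  #|[set y in nbh a | deg y <= 6]| + 7 <= deg a.
Proof.
move=> ca; have /andP[xa wa] := ca.
pose U := (nbh x :|: nbh w) :\ x :\ a.
have cU : #|U| = 7.
  have := cardsU (nbh x) (nbh w); rewrite common3 -/(deg x) -/(deg w) dx5 dw.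
  have := cardsD1 x (nbh x :|: nbh w); have := cardsD1 a ((nbh x :|: nbh w) :\ x).
  by rewrite -/U !inE irrE xa (symE w x) exw (eq_sym a x) (adj_neq xa) /=; lia.
have Ua : U \subset nbh a :\: [set y | deg y <= 6].
  apply/subsetP => y; rewrite !inE -ltnNge => /and3P[ya yx].
  have [xy _|nxy /= wy] := boolP (e x y).
    rewrite (small_nonadjacent xy dx) /=.
    by have /subsetP/(_ y) := common_dominates ca; rewrite !inE ya xy => /(_ isT).
  have oy : only_w y by rewrite /only_w yx wy.
  by rewrite only_w_large // common_only_w.
have := cardsID [set y | deg y <= 6] (nbh a); rewrite -/(deg a) => <-.
apply: leq_add; last by rewrite -cU subset_leq_card.
by apply/eq_leq/eq_card => y; rewrite !inE.
Qed.

End Exceptional.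

(** * Small neighbours of a large vertex *)

Definition small_nbh w := [set x in nbh w | deg x <= 6].

Lemma small_nbhP w x : reflect (e w x /\ deg x <= 6) (x \in small_nbh w).
Proof. by rewrite !inE; apply: andP. Qed.

Lemma low_of_small_nbh w x : x \in small_nbh w -> low x.
Proof.
case/small_nbhP=> wx dx; apply: (low_of_deg); rewrite dx andbT.
by rewrite symE in wx; apply: deg_gt0 wx.
Qed.

Lemma small_nbh_independent w x y :
  x \in small_nbh w -> y \in small_nbh w -> ~~ e x y.
Proof.
move=> /small_nbhP[_ dx] /small_nbhP[_ dy]; apply/negP => xy.
by have := small_nonadjacent xy dx; rewrite ltnNge dy.
Qed.

(** Small neighbours listed first get the numbers 1 to [size xs]. They are low and pairwise
    nonadjacent, which justifies the list of low vertices and the absent pairs [pairs_of k]. *)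
Lemma small_nbh_check w xs r closed reds E A d :
  {subset xs <= small_nbh w} -> uniq (xs ++ r) ->
  (forall x, (x \in xs ++ r) = e w x) ->
  (forall i, i \in closed -> forall y, e (nth w (w :: xs ++ r) i) y -> y \in w :: xs ++ r) ->
  facts (w :: xs ++ r) w E A ->
  let k := iota 1 (size xs) in
  check_one (size (xs ++ r)) closed k reds E (A ++ pairs_of k) d -> False.
Proof.
move=> xsS u rE cl fct k.
have nthS i : i \in k -> nth w (w :: xs ++ r) i \in small_nbh w.
  rewrite mem_iota add1n => /andP[i0 ik]; apply: xsS.
  by case: i i0 ik => // i _ ik /=; rewrite nth_cat -ltnS ik mem_nth.
apply: (one_center u rE cl) => [i /nthS/low_of_small_nbh//|].
rewrite -[E]cats0 facts_cat fct /facts /=; apply/allP => p.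
rewrite mem_filter => /andP[_ /allpairsP[q [q1 q2 ->]]].
by apply: small_nbh_independent; apply: nthS.
Qed.

Lemma pick_small w k : k <= #|small_nbh w| -> 
  exists xs r, [/\ size xs = k, {subset xs <= small_nbh w}, uniq (xs ++ r)
    & forall x, (x \in xs ++ r) = e w x].
Proof.
move=> kS; pose xs := take k (enum (small_nbh w)).
have xsS : {subset xs <= small_nbh w} by move=> x /mem_take; rewrite mem_enum.
have [||r [ur rE]] := @enum_extend (e w) xs; first by rewrite take_uniq ?enum_uniq.
  by apply/allP => x /xsS/small_nbhP[].
by exists xs, r; split=> //; rewrite size_takel // -cardE.
Qed.

(** Six small neighbours would leave three others, and each small one would be adjacent to all
    three. A matching between the two kinds packs three triangles, while the three spokes to the
    others hit every triangle at w, because the small ones are independent. *)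
Lemma small_nbh9 w : deg w = 9 -> #|small_nbh w| <= 5.
Proof.
move=> dw; rewrite leqNgt; apply/negP => /pick_small[xs [r [sx xsS u rE]]].
have sr := size_nbh u rE; rewrite dw in sr.
apply: (small_nbh_check xsS u rE (closed := [::]) (E := [::]) (A := [::])) => //.
by rewrite sr sx; exact: nine_ok.
Qed.

(** Each of four small neighbours is adjacent to at least three of the other four. By Hall's theorem
    there is a perfect matching, and the spokes to those other four hit all triangles at w, unless
    one of the four is adjacent to no small neighbour; then three spokes and three matching edges
    suffice. *)
Lemma small_nbh8 w : deg w = 8 -> #|small_nbh w| <= 3.
Proof.
move=> dw; rewrite leqNgt; apply/negP => /pick_small[xs [r [sx xsS u rE]]].
have sr := size_nbh u rE; rewrite dw in sr.
apply: (small_nbh_check xsS u rE (closed := [::]) (E := [::]) (A := [::])) => //.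
by rewrite sr sx; exact: eight_ok.
Qed.

Lemma shared_miss w a b c z : deg w = 8 -> uniq [:: a; b; c; z] ->
  {subset [:: a; b; c] <= small_nbh w} -> e w z -> ~~ e a z -> e b z.
Proof.
move=> dw u abcS wz az; apply/negPn/negP => bz.
have [|r [ur rE]] := @enum_extend (e w) [:: a; b; c; z] u.
  apply/allP => x; rewrite (mem_cat x [:: a; b; c] [:: z]) mem_seq1.
  by case/orP=> [/abcS/small_nbhP[]|/eqP->].
have sr := size_nbh ur rE; rewrite dw in sr.
apply: (@small_nbh_check w [:: a; b; c] (z :: r) [::] _ [::]
  [:: (1, 4); (2, 4)] _ abcS ur rE) => //.
  by rewrite /facts /= az bz.
by rewrite sr; exact: shared_ok.
Qed.

(** Five neighbours of w lie outside S, while a has only four neighbours besides w. *)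
Lemma missed_neighbour w S a : deg w = 8 -> uniq S -> size S = 3 ->
  {subset S <= small_nbh w} -> a \in S -> deg a = 5 ->
  exists2 m, e w m /\ m \notin S & ~~ e a m.
Proof.
move=> dw uS sS SS aS da; have [wa _] := small_nbhP _ _ (SS a aS).
have [|r [ur rE]] := @enum_extend (e w) S uS.
  by apply/allP => x /SS/small_nbhP[].
have sr := size_nbh ur rE; rewrite size_cat sS dw in sr.
have [/allP h|/allPn[m mr am]] := boolP (all (e a) r); last first.
  exists m => //; split; first by rewrite -rE mem_cat mr orbT.
  by move: ur; rewrite cat_uniq => /and3P[_ /hasPn h _]; apply: h.
have := common_lt (u := a) (v := w); rewrite symE wa da => /(_ isT).
rewrite ltnNge => /negP[].
have -> : 5 = #|[set x in r]|.
  by rewrite cardsE; move: ur; rewrite cat_uniq => /and3P[_ _ /card_uniqP->]; case: sr.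
apply/subset_leq_card/subsetP => x; rewrite !inE => xr.
by rewrite h // -rE mem_cat xr orbT.
Qed.

(** * Three neighbours of degree 5 at a vertex of degree 8 *)

Section Eight.
Variables (w : T) (S : seq T).
Hypotheses (dw : deg w = 8) (uS : uniq S) (sS : size S = 3).
Hypotheses (SS : {subset S <= small_nbh w}) (S5 : {in S, forall x, deg x = 5}).

Let outside z := e w z /\ z \notin S.

Lemma miss_once x y z : x \in S -> y \in S -> x != y -> outside z ->
  ~~ e x z -> e y z.
Proof.
move=> xS yS xy [wz zS].
have [||r [ur rE]] := @enum_extend (mem S) [:: x; y]; rewrite /= ?inE ?xy ?xS ?yS //.
have pS : perm_eq ([:: x; y] ++ r) S by apply: uniq_perm.
have := perm_size pS; rewrite sS; case: r ur rE pS => [|t [|? ?]] // ur rE pS _.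
apply: (@shared_miss w x y t z dw) => //; last by move=> u; rewrite rE; apply: SS.
by rewrite -[[:: x, _ & _]]/(rcons ([:: x; y] ++ [:: t]) z) rcons_uniq ur rE zS.
Qed.

(** If a missed only one outside vertex, its whole neighbourhood would be known: w and the four
    other outside vertices. Since b and c miss vertices different from that one and from each other,
    [distinct_ok] applies. *)
Lemma several_misses a m : a \in S ->
  ~ (forall y, outside y -> ~~ e a y -> y = m).
Proof.
move=> aS am.
have [|r [ur rE]] := @enum_extend (mem S) [:: a] isT; first by rewrite /= aS.
have pS : perm_eq ([:: a] ++ r) S by apply: uniq_perm.
have := perm_size pS; rewrite sS; case: r ur rE pS => [|b [|c [|? ?]]] // ur rE pS _.
have inS x : (x \in S) = (x \in [:: a; b; c]) by rewrite rE.
have [bS cS] : b \in S /\ c \in S by rewrite !inS !inE !eqxx !orbT.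
have [ma [wma maS] nma] := missed_neighbour dw uS sS SS aS (S5 aS).
have [mb [wmb mbS] nmb] := missed_neighbour dw uS sS SS bS (S5 bS).
have [mc [wmc mcS] nmc] := missed_neighbour dw uS sS SS cS (S5 cS).
have := ur; rewrite /= !inE !negb_or => /and3P[/andP[ab ac] bc _].
have [amb amc] : e a mb /\ e a mc.
  by split; [apply: (miss_once bS aS)|apply: (miss_once cS aS)]; rewrite // eq_sym.
have [bma bmc] : e b ma /\ e b mc.
  by split; [apply: (miss_once aS bS)|apply: (miss_once cS bS)]; rewrite // eq_sym.
have [cma cmb] : e c ma /\ e c mb.
  by split; [apply: (miss_once aS cS)|apply: (miss_once bS cS)]; rewrite // eq_sym.
have mab : ma != mb by apply: contraNneq nma => ->.
have mac : ma != mc by apply: contraNneq nma => ->.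
have mbc : mb != mc by apply: contraNneq nmb => ->.
have um : uniq ([:: a; b; c] ++ [:: ma; mb; mc]).
  rewrite cat_uniq ur; apply/and3P; split=> //; last by rewrite /= !inE negb_or mab mac mbc.
  apply/hasPn => x xm; rewrite -[~~ _]/(x \notin [:: a; b; c]) -inS.
  by move: xm; rewrite !inE => /or3P[]/eqP->.
have wS x : x \in S -> e w x by move=> /SS/small_nbhP[].
have [|r' [ur' rE']] := @enum_extend (e w) _ um.
  apply/allP => x; rewrite mem_cat -inS => /orP[/wS//|].
  by rewrite !inE => /or3P[]/eqP->.
have sr := size_nbh ur' rE'; rewrite dw in sr.
case: r' ur' rE' sr => [|p [|q [|? ?]]] // ur' rE' sr.
have apq x : x \in [:: p; q] -> e a x.
  move=> xpq; have xr : x \in ([:: a; b; c] ++ [:: ma; mb; mc]) ++ [:: p; q].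
    by rewrite mem_cat xpq orbT.
  have xn : x \notin [:: a; b; c] ++ [:: ma; mb; mc].
    by move: ur'; rewrite cat_uniq => /and3P[_ /hasPn/(_ x xpq)].
  have ox : outside x by split; [rewrite -rE'|apply: contraNN xn; rewrite inS mem_cat => ->].
  apply: contraNT xn => nax; have -> : x = m by apply: am.
  by rewrite -(am ma (conj wma maS) nma) mem_cat !inE eqxx !orbT.
have [ap aq] : e a p /\ e a q by split; apply: apq; rewrite !inE eqxx ?orbT.
(* As a has degree 5, these five neighbours are all of them, so a is closed in the certificate. *)
have cl y : e a y -> y \in [:: w; mb; mc; p; q].
  have ul : uniq [:: w; mb; mc; p; q].
    have sub : subseq [:: mb; mc; p; q] (([:: a; b; c] ++ [:: ma; mb; mc]) ++ [:: p; q]).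
      exact: (suffix_subseq [:: a; b; c; ma]).
    rewrite cons_uniq (subseq_uniq sub ur') andbT; apply: contraFN (irrE w) => wm.
    by rewrite -rE' (mem_subseq sub).
  have [|l [ul' lE]] := @enum_extend (e a) _ ul.
    by rewrite /= symE (wS a aS) amb amc ap aq.
  have := size_nbh ul' lE; rewrite S5 //; case: l ul' lE => // ul' lE _.
  by rewrite -lE.
apply: (@small_nbh_check w [:: a; b; c] [:: ma; mb; mc; p; q] [:: 1] _
  (star 1 (iota 5 4) ++ [:: (2, 4); (3, 4); (3, 5); (2, 6)])
  [:: (1, 4); (2, 5); (3, 6)] _ _ ur' rE' _ _ distinct_ok).
- by move=> x xabc; apply: SS; rewrite inS.
- have sub : all (mem (w :: [:: a; b; c] ++ [:: ma; mb; mc; p; q])) [:: w; mb; mc; p; q].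
    by rewrite /= !inE !eqxx !orbT.
  by move=> i; rewrite inE => /eqP -> y /cl; apply: (allP sub).
by rewrite /facts /= amb amc ap aq bma bmc cma cmb nma nmb nmc.
Qed.

End Eight.

(** Three neighbours of degree 5 would each miss at least two of the five outside vertices, and no
    outside vertex is missed twice; this would require six outside vertices. *)
Lemma fives8 w : deg w = 8 -> #|[set x in nbh w | deg x == 5]| <= 2.
Proof.
move=> dw; rewrite leqNgt; apply/negP => /card_gt2P[a [b [c [[aF bF cF] [ab bc ca]]]]].
pose S := [:: a; b; c].
have uS : uniq S by rewrite /= !inE negb_or ab bc eq_sym ca.
have SF x : x \in S -> e w x /\ deg x = 5.
  rewrite !inE => xS; have : x \in [set x in nbh w | deg x == 5] by case/or3P: xS => /eqP->.
  by rewrite !inE => /andP[-> /eqP].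
have SS : {subset S <= small_nbh w} by move=> x /SF[wx dx]; apply/small_nbhP; rewrite wx dx.
have S5 : {in S, forall x, deg x = 5} by move=> x /SF[].
pose M x := [set y | [&& e w y, y \notin S & ~~ e x y]].
have M2 x : x \in S -> 1 < #|M x|.
  move=> xS; rewrite ltnNge; apply/negP => M1.
  have [m [wm mS] nm] := missed_neighbour dw uS erefl SS xS (S5 x xS).
  apply: (several_misses dw uS erefl SS S5 (m := m) xS) => y [wy yS] ny.
  by apply: (card_le1_eqP M1); rewrite inE ?wy ?yS ?wm ?mS ?ny ?nm.
have Md x y : x \in S -> y \in S -> x != y -> [disjoint M x & M y].
  move=> xS yS xy; rewrite disjoint_subset; apply/subsetP => z; rewrite inE => /and3P[wz zS nxz].
  by rewrite inE in_set wz zS (miss_once dw uS erefl SS xS yS xy (conj wz zS) nxz).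
have cS3 : #|[set x in S]| = 3 by rewrite cardsE (card_uniqP uS).
have [aS bS cS] : [/\ a \in S, b \in S & c \in S] by rewrite !inE !eqxx !orbT.
have dab := Md a b aS bS ab; have dbc := Md b c bS cS bc.
have dac : [disjoint M a & M c] by apply: Md; rewrite // eq_sym.
have sub : M a :|: M b :|: M c \subset nbh w :\: [set x in S].
  by apply/subsetP => y; rewrite !inE -!andb_orr => /andP[-> /andP[-> _]].
have := subset_leq_card sub; rewrite !cardsU (disjoint_setI0 dab) setIUl.
rewrite (disjoint_setI0 dac) (disjoint_setI0 dbc) setU0 cards0.
rewrite cardsD (setIidPr _); last by apply/subsetP => y; rewrite inE => /SF[wy _]; rewrite inE.
rewrite cS3 -/(deg w) dw.
rewrite !subn0; apply/negP; rewrite -ltnNge.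
exact: leq_add (leq_add (M2 a aS) (M2 b bS)) (M2 c cS).
Qed.

(** * Discharging *)

Definition exceptional x := [exists w, e x w && (deg w == 7)].
Definition dominates v x := nbh x :\ v \subset nbh v.

(* The amount, in units of 1/30, that [v] sends to [x]. An exceptional vertex has
   at least three dominating neighbours, so that in all cases a vertex of degree
   5 receives 2 and a vertex of degree 6 receives 1. *)
Definition charge v x :=
  if ~~ e v x then 0 else
  if deg x == 6 then 5 else
  if deg x != 5 then 0 else
  if exceptional x then if dominates v x then 20 else 0
  else 12.

Definition given v := \sum_x charge v x.
Definition received x := \sum_v charge v x.

Lemma leq_card_sum (A : {set T}) c (F : T -> nat) :
  {in A, forall x, c <= F x} -> c * #|A| <= \sum_x F x.
Proof.
move=> h; rewrite mulnC -sum_nat_const [leqRHS](bigID (mem A)) /=.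
by apply: leq_trans (leq_addr _ _); apply: leq_sum.
Qed.

Lemma received_six x : deg x = 6 -> 30 <= received x.
Proof.
move=> dx; rewrite -[30]/(5 * 6) -dx; apply: leq_card_sum => v; rewrite inE => xv.
by rewrite /charge symE xv /= dx eqxx.
Qed.

Lemma received_five x : deg x = 5 -> 60 <= received x.
Proof.
move=> dx; have [exc|nexc] := boolP (exceptional x); last first.
  rewrite -[60]/(12 * 5) -[X in 12 * X]dx; apply: leq_card_sum => v; rewrite inE => xv.
  by rewrite /charge symE xv /= dx /= (negPf nexc).
have /existsP[w /andP[xw /eqP dw]] := exc.
have dx6 : deg x <= 6 by rewrite dx.
have [_ c3] := seven_neighbour xw dx6 dw.
rewrite -[60]/(20 * 3) -[X in 20 * X]c3; apply: leq_card_sum => v; rewrite !inE => cv.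
have dom := common_dominates xw dx6 dw cv.
by case/andP: cv => xv _; rewrite /charge symE xv /= dx /= exc /dominates dom.
Qed.

Lemma charge_small v x : x \notin small_nbh v -> charge v x = 0.
Proof.
rewrite /charge !inE negb_and; case: (e v x) => //= h.
by case: eqP h => [->|_] //; case: eqP => [->|_].
Qed.

Lemma given_sum v : given v = \sum_(x in small_nbh v) charge v x.
Proof.
rewrite /given (bigID (mem (small_nbh v))) /= [X in _ + X]big1 ?addn0 //.
by move=> x /charge_small.
Qed.

Lemma given_leq v c : {in small_nbh v, forall x, charge v x <= c} ->
  given v <= c * #|small_nbh v|.
Proof. by move=> h; rewrite given_sum mulnC -sum_nat_const; apply: leq_sum. Qed.

Lemma given_small v : deg v <= 6 -> given v = 0.
Proof.
move=> dv; rewrite given_sum big1 // => x /small_nbhP[vx dx].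
by have := small_nonadjacent vx dv; rewrite ltnNge dx.
Qed.

(** The small vertex x shares at least three neighbours with v, and every neighbour of x is
    large. *)
Lemma small_nbh_leq v x : x \in small_nbh v -> #|small_nbh v| + 3 <= deg v.
Proof.
move=> xS; have [vx dx] := small_nbhP _ _ xS.
have lx := low_of_small_nbh xS.
have xv : e x v by rewrite symE.
have c3 := low_common lx xv; have [d4 _] := lx.
have sub : nbh x :&: nbh v \subset nbh v :\: small_nbh v.
  apply/subsetP => y; rewrite !inE => /andP[xy vy]; rewrite vy andbT /= -ltnNge.
  exact: (small_nonadjacent xy dx).
have Sv : small_nbh v \subset nbh v by apply/subsetP => y; rewrite !inE => /andP[].
have := subset_leq_card sub; rewrite cardsD (setIidPr Sv) -/(deg v).
have := subset_leq_card Sv; rewrite -/(deg v); lia.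
Qed.

(** The degree-7 vertex w behind the exception does not dominate x, being adjacent to only three of
    its four other neighbours. So v differs from w, is adjacent to it by domination, and
    [common_small_neighbours] applies to v. *)
Lemma small_nbh_exceptional v x : x \in small_nbh v -> exceptional x ->
  dominates v x -> #|small_nbh v| + 7 <= deg v.
Proof.
move=> /small_nbhP[vx dx] /existsP[w /andP[xw /eqP dw]] dom.
have [dx5 c3] := seven_neighbour xw dx dw.
have [wv|wv] := eqVneq w v.
  have : nbh x :\ v \subset nbh x :&: nbh w by rewrite subsetI subsetDl wv.
  move/subset_leq_card; rewrite c3; have := cardsD1 v (nbh x).
  by rewrite -/(deg x) dx5 inE symE vx; lia.
have vw : e v w by move/subsetP: dom => /(_ w); rewrite !inE wv xw => /(_ isT).
by apply: (common_small_neighbours xw dx dw); rewrite symE vx symE.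
Qed.

Lemma given_large v : 6 < deg v -> given v + 210 <= 30 * deg v.
Proof.
move=> dv.
have [/existsP[x /and3P[xS exc dom]]|/existsPn noexc] :=
    boolP [exists x, [&& x \in small_nbh v, exceptional x & dominates v x]].
  (* At most deg v - 7 neighbours are small, and 20 for each stays within the available 30 (deg v -
     7). *)
  have := small_nbh_exceptional xS exc dom.
  have : given v <= 20 * #|small_nbh v|.
    by apply: given_leq => y _; rewrite /charge; repeat case: ifP => _ //.
  lia.
(* Without a dominated exceptional neighbour the share 20 never occurs: at most 12 goes to a vertex
   of degree 5, and 5 to one of degree 6. *)
have c12 x : x \in small_nbh v -> charge v x <= 5 + 7 * (deg x == 5).
  move=> xS; have := noexc x; rewrite xS /charge /=.
  case: ifP => // _; case: ifP => // _; case: eqP => //= _.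
  by case: ifP => //= _; case: ifP.
have g12 : given v <= 12 * #|small_nbh v|.
  by apply: given_leq => x /c12 /leq_trans; apply; case: eqP.
have [d7|[d8|[d9|d10]]] : deg v = 7 \/ deg v = 8 \/ deg v = 9 \/ 9 < deg v by lia.
(* A vertex of degree 7 itself makes its small neighbours exceptional, and in this case it dominates
   none of them, so it sends nothing. *)
- suff -> : given v = 0 by rewrite d7.
  rewrite given_sum big1 // => x xS; have [vx dx] := small_nbhP _ _ xS.
  have xv : e x v by rewrite symE.
  have exc : exceptional x by apply/existsP; exists v; rewrite xv d7 eqxx.
  have [dx5 _] := seven_neighbour xv dx d7.
  by have := noexc x; rewrite /charge vx dx5 xS exc /= => /negPf ->.
(* Three small neighbours, at most two of degree 5, cost at most 3 * 5 + 2 * 7 = 29, and 30 is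
   available. *)
- suff : given v <= 29 by rewrite d8; lia.
  rewrite given_sum; apply: leq_trans (leq_sum _ c12) _.
  rewrite big_split /= sum_nat_const -big_distrr /=.
  have -> : \sum_(x in small_nbh v) (deg x == 5) = #|[set x in nbh v | deg x == 5]|.
    rewrite -sum1_card big_mkcond [RHS]big_mkcond; apply: eq_bigr => x _.
    by rewrite !inE; case: (e v x) => //=; case: eqP => [->|_] //; case: ifP.
  by have := small_nbh8 d8; have := fives8 d8; lia.
(* Five shares of 12 use up exactly the available 60. *)
- by have := small_nbh9 d9; lia.
(* From degree 10 on, 12 (d - 3) <= 30 (d - 7) holds. *)
have [S0|/set0Pn[x /small_nbh_leq]] := eqVneq (small_nbh v) set0; last lia.
by move: g12; rewrite S0 cards0; lia.
Qed.

(** The number 210 is degree 7 in units of 1/30. The factor [0 < deg v] exempts isolated vertices,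
    which have no charge and send none. *)
Lemma balance v : 210 * (0 < deg v) + given v <= 30 * deg v + received v.
Proof.
have [|d6] := leqP (deg v) 6; last by have := given_large d6; have -> : 0 < deg v; lia.
move=> d6; rewrite given_small // addn0; have [->//|d0] := posnP (deg v).
have [d4 _] : low v by apply: (low_of_deg); rewrite d0.
have [d5|d6'] : deg v = 5 \/ deg v = 6 by lia.
  by have := received_five d5; lia.
by have := received_six d6'; lia.
Qed.

(** * Counting edges *)

Lemma sum_deg : \sum_v deg v <= 2 * #|edges e|.
Proof.
have incident v : deg v <= \sum_(A in edges e) (v \in A).
  have -> : \sum_(A in edges e) (v \in A) = #|[set A in edges e | v \in A]|.
    rewrite -sum1_card big_mkcond [RHS]big_mkcond; apply: eq_bigr => A _.
    by rewrite inE; case: ifP => //= _; case: (v \in A).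
  rewrite -[deg v]/(#|nbh v|) -(card_in_imset (f := fun u => [set v; u])).
    apply/subset_leq_card/subsetP => A /imsetP[u]; rewrite in_nbh => vu ->.
    by rewrite inE set21 andbT; apply/edgesP; exists v, u.
  move=> x y; rewrite !in_nbh => vx vy exy.
  have : x \in [set v; y] by rewrite -exy set22.
  by rewrite !inE => /orP[/eqP xv|/eqP//]; rewrite xv irrE in vx.
apply: (@leq_trans (\sum_v \sum_(A in edges e) (v \in A))); first exact: leq_sum.
rewrite exchange_big /= mulnC -sum_nat_const; apply: leq_sum => A /edgesP[x [y [xy ->]]].
have -> : \sum_v (v \in [set x; y]) = #|[set x; y]|.
  by rewrite -sum1_card [RHS]big_mkcond; apply: eq_bigr => v _; case: ifP.
by rewrite cards2; case: eqP.
Qed.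

(** Summing [balance] over all vertices, the amounts given and received cancel after exchanging the
    order of summation. *)
Lemma edges_lower_bound : 7 * #|[set v | 0 < deg v]| <= 2 * #|edges e|.
Proof.
have := leq_sum (index_enum T) (P := xpredT) (fun v _ => balance v).
rewrite [leqLHS]big_split [leqRHS]big_split -!big_distrr /=.
have -> : \sum_v received v = \sum_v given v by rewrite /received exchange_big.
rewrite leq_add2r.
have -> : \sum_v (0 < deg v) = #|[set v | 0 < deg v]|.
  by rewrite -sum1_card [RHS]big_mkcond; apply: eq_bigr => v _; rewrite inE; case: ifP.
rewrite -[210]/(30 * 7) -mulnA leq_pmul2l // => h.
exact: leq_trans h sum_deg.
Qed.

End Irreducible.

Theorem theorem1p2 (T : finType) (e : rel T) :
  simple_graph e -> mad_lt e 7 1 ->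
  forall nu tau, is_nu e nu -> is_tau e tau -> tau <= 2 * nu.
Proof.
move=> simple_e mad nu tau [_ nu_max] [_ tau_min].
apply: contraT => lt; exfalso.
have noirr e' : simple_graph e' -> mad_lt e' 7 1 -> edges e' != set0 -> ~ @irreducible T e'.
  move=> simple_e' mad' /set0Pn[B /edgesP[u [v [uv _]]]] irr.
  (* The subgraph contradicting mad < 7 consists of all edges on the non-isolated vertices; it has a
     vertex because an edge exists. *)
  have := edges_lower_bound simple_e' irr; have := mad' [set v | 0 < deg e' v] (edges e').
  rewrite muln1 => h; rewrite leqNgt => /negP; apply; apply: h.
    split=> // A /edgesP[x [y [xy ->]]]; rewrite subUset !sub1set !inE (deg_gt0 xy).
    by case: simple_e' => sym _; rewrite sym in xy; rewrite (deg_gt0 xy).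
  by apply/set0Pn; exists u; rewrite inE (deg_gt0 uv).
apply: (minimal_counterexample noirr simple_e mad).
case=> P [Y [Pd Yt leYP]]; move/negP: lt; apply.
apply: leq_trans (tau_min Y Yt) (leq_trans leYP _).
by rewrite leq_mul2l nu_max.
Qed.
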